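(* Let $k\ge2$ and let $N=C_1-\dots-C_k$ be a manifold of sewed, (pairwise) locally isomorphic cells $C_i=(C_i,\varphi_i,\xi_i,\eta_i,g_i)$, $i=1,\dots,k$, with its almost contact metric structure $(\varphi,\xi,\eta,g)$. Assume that each cell $C_i$ satisfies a generalized $(\kappa_i,\mu_i,\mu_i')$-nullity condition, where the functions $\kappa_i,\mu_i,\mu_i'$ on $C_i$ are arbitrary provided that $d\kappa_i\wedge\eta_i=d\mu_i\wedge\eta_i=d\mu_i'\wedge\eta_i=0$. Then the manifold of sewed cells $N$ satisfies a generalized $(\kappa,\mu,\mu')$-nullity condition with uniquely determined functions $\kappa,\mu,\mu'$ on $N$ such that $d\kappa\wedge\eta=d\mu\wedge\eta=d\mu'\wedge\eta=0$.
   Context: An almost contact metric structure on a manifold is a quadruple $(\varphi,\xi,\eta,g)$ of a $(1,1)$-tensor field (affinor) $\varphi$, a vector field $\xi$, a one-form $\eta$ and a Riemannian metric $g$ with $\varphi^2=-Id+\eta\otimes\xi$, $\eta(\xi)=1$, $g(\varphi X,\varphi Y)=g(X,Y)-\eta(X)\eta(Y)$. Put $h=\frac12\mathcal{L}_\xi\varphi$ and $h'=h\varphi$. With $R(X,Y)Z=\nabla_X\nabla_YZ-\nabla_Y\nabla_XZ-\nabla_{[X,Y]}Z$, the manifold satisfies the generalized $(\kappa,\mu,\mu')$-nullity condition, where $\kappa,\mu,\mu'$ are functions on the manifold, if for all vector fields $X,Y$ $$R(X,Y)\xi=\kappa(\eta(Y)X-\eta(X)Y)+\mu(\eta(Y)hX-\eta(X)hY)+\mu'(\eta(Y)h'X-\eta(X)h'Y).$$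 A cell is a 3-dimensional almost contact metric manifold $(M^3,\varphi,\xi,\eta,g)$ with $d\eta=0$. Two cells $(C_1,\varphi_1,\xi_1,\eta_1,g_1)$, $(C_2,\varphi_2,\xi_2,\eta_2,g_2)$ are locally isomorphic if for any points $x_1\in C_1$, $x_2\in C_2$ there are neighborhoods $x_1\in U^1\subset C_1$, $x_2\in U^2\subset C_2$ and a diffeomorphism $\theta:U^1\to U^2$ with $\theta(x_1)=x_2$ preserving the structures: $\theta_*\circ\varphi_1=\varphi_2\circ\theta_*$, $\xi_2=\theta_*\xi_1$, $\eta_1=\theta^*\eta_2$, $g_1=\theta^*g_2$. Product of cells: $M=C_1\times\dots\times C_k$ with projections $\pi_i:M\to C_i$; $D_i=\bigcap_{j\ne i}\mathrm{Ker}\,\pi_{*j}$, so $TM=D_1\oplus\dots\oplus D_k$. The lift of a vector field $X$ on $C_i$ is the unique vector field $\bar X\in\Gamma(D_i)$ with $\pi_{*i}(\bar X)=X$. $\bar\varphi_i$ is the $(1,1)$-tensor field on $M$ with $\bar\varphi_i\bar X=\overline{\varphi_iX}$ for lifts $\bar X$ of vector fields on $C_i$ and $\bar\varphi_i=0$ on $D_j$, $j\neq i$. Put $f=\sum_{i=1}^k\bar\varphi_i$, $\bar g=\sum_{i=1}^k\pi_i^*g_i$, $\bar\xi_i$ = the lift of $\xi_i$, $\bar\eta_i=\pi_i^*\eta_i$, $\bar\xi=(\bar\xi_1+\dots+\bar\xi_k)/\sqrt{k}$. The distribution $Im(f)\oplus\mathbb{R}\bar\xi$ on $M$ is involutive;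 the (maximal connected) integral submanifold $N\subset M$ of it through a point of $M$ is called a manifold of sewed cells, denoted $N=C_1-\dots-C_k$; with $\iota:N\to M$ the inclusion, it carries the almost contact metric structure $\varphi=f|_N$, $\xi=\bar\xi|_N$, $\eta=\sqrt{k}\,\iota^*\bar\eta_1$, $g=\bar g|_N$.
   Formalization: Uniqueness is claimed for κ everywhere but for μ, μ' only at points where h ≠ 0, since where h = 0 (e.g. all cells flat cosymplectic R³) the condition leaves μ and μ' arbitrary. *)

(* Defs.v *)
From HB Require Import structures.
From mathcomp Require Import all_boot all_order all_algebra.
From mathcomp Require Import all_classical all_reals all_analysis.
Set Implicit Arguments.
Unset Strict Implicit.
Unset Printing Implicit Defensive.
Import Order.TTheory GRing.Theory Num.Theory numFieldNormedType.Exports.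
Local Open Scope classical_set_scope.
Local Open Scope ring_scope.

(* Conventions.  Tangent vectors are written in coordinates as row vectors;   *)
(* an affinor A acts as v |-> v *m A, a one-form a (a column) as v |-> v *m a *)
(* and a metric G as (u, v) |-> u *m G *m v^T.                                *)

Section LocalCalculus.
Context {R : realType} {n : nat}.
Implicit Types (V : normedModType R) (X Y Z : 'rV[R]_n -> 'rV[R]_n).

Definition ebase (i : 'I_n) : 'rV[R]_n := delta_mx 0 i.

Definition partials V (s : seq 'I_n) (f : 'rV[R]_n -> V) : 'rV[R]_n -> V :=
  foldr (fun i h => 'D_(ebase i) h) f s.

(* C^oo on the open set U: all iterated partial derivatives are               *)
(* differentiable at the points of U.                                         *)
Definition smooth_on V (U : set 'rV[R]_n) (f : 'rV[R]_n -> V) : Prop :=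
  forall (s : seq 'I_n) x, U x -> differentiable (partials s f) x.

Definition ev (a : 'cV[R]_n) (u : 'rV[R]_n) : R := (u *m a) 0 0.

Definition bil (G : 'M[R]_n) (u v : 'rV[R]_n) : R := (u *m G *m v^T) 0 0.

Definition bracket X Y (x : 'rV[R]_n) : 'rV[R]_n :=
  'D_(X x) Y x - 'D_(Y x) X x.

(* (L_xi A) X = [xi, A X] - A [xi, X], evaluated on the coordinate fields     *)
(* X = ebase i, for which A X is the i-th row of A.                           *)
Definition lie_affinor (xi : 'rV[R]_n -> 'rV[R]_n) (A : 'rV[R]_n -> 'M[R]_n)
    (x : 'rV[R]_n) : 'M[R]_n :=
  \matrix_(i < n) (bracket xi (fun y => row i (A y)) x
                   - bracket xi (cst (ebase i)) x *m A x).

(* (d a)(u, v), u and v being extended to fields with constant coefficients.  *)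
Definition ext_d (a : 'rV[R]_n -> 'cV[R]_n) (x u v : 'rV[R]_n) : R :=
  ev ('D_u a x) v - ev ('D_v a x) u.

(* Levi-Civita connection of the metric G.  [christoffel1 G x u v] is the     *)
(* one-form w |-> g(nabla_u v, w) given by Koszul's formula for fields u, v,  *)
(* w with constant coefficients; [christoffel2] raises the index.             *)
Definition christoffel1 (G : 'rV[R]_n -> 'M[R]_n) (x u v : 'rV[R]_n) :
    'rV[R]_n :=
  \row_(j < n) (2^-1 * (bil ('D_u G x) v (ebase j) + bil ('D_v G x) u (ebase j)
                        - bil ('D_(ebase j) G x) u v)).

Definition christoffel2 (G : 'rV[R]_n -> 'M[R]_n) (x u v : 'rV[R]_n) :
    'rV[R]_n :=
  christoffel1 G x u v *m invmx (G x).

Definition nabla (G : 'rV[R]_n -> 'M[R]_n) X Y (x : 'rV[R]_n) : 'rV[R]_n :=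
  'D_(X x) Y x + christoffel2 G x (X x) (Y x).

Definition curvature (G : 'rV[R]_n -> 'M[R]_n) X Y Z (x : 'rV[R]_n) :
    'rV[R]_n :=
  nabla G X (nabla G Y Z) x - nabla G Y (nabla G X Z) x
  - nabla G (bracket X Y) Z x.

End LocalCalculus.

Section Smooth.
Context {R : realType} {n : nat}.
Implicit Types (V : normedModType R).

Lemma smooth_diff V U (f : 'rV[R]_n -> V) : smooth_on U f ->
   forall x, U x -> differentiable f x.
Proof. by move=> H x; exact: (H [::]). Qed.

Lemma smooth_partial V U (f : 'rV[R]_n -> V) i : smooth_on U f ->
   smooth_on U (fun x => 'D_(ebase i) f x).
Proof.
move=> H s x Ux; have := H (rcons s i) x Ux.
by rewrite /partials -cats1 foldr_cat.
Qed.

Lemma diff_near_eq V (f g : 'rV[R]_n -> V) x :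
  (\near x, f x = g x) -> differentiable g x -> differentiable f x.
Proof.
move=> e dg.
have e0 : \forall h \near (0 : 'rV[R]_n), f (h + x) = g (h + x).
  by move: e; rewrite (near_shift 0) subr0.
have fx : f x = g x by exact: nbhs_singleton e.
have [cdg /eqaddoP og] := (diff_locallyP x g).1 dg.
have of' : f \o shift x = cst (f x) + 'd g x +o_ (0 : 'rV[R]_n) id.
  apply/eqaddoP => eps eps0; near=> h.
  have -> : (f \o shift x - (cst (f x) + 'd g x)) h = (g \o shift x - (cst (g x) + 'd g x)) h.
    by rewrite !fctE /= fx; congr (_ - _); near: h.
  by near: h; exact: og.
have H := diff_unique cdg of'.
by apply/diff_locallyP; split; rewrite H.
Unshelve. all: by end_near.
Qed.

Lemma smooth_ind V U (P : ('rV[R]_n -> V) -> Prop) : open U ->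
  (forall f, P f -> forall x, U x -> differentiable f x) ->
  (forall f i, P f -> exists2 g, P g & forall x, U x -> 'D_(ebase i) f x = g x) ->
  forall f, P f -> smooth_on U f.
Proof.
move=> oU Pd Pp f Pf s.
have [g Pg eg] : exists2 g, P g & forall x, U x -> partials s f x = g x.
  elim: s => [|i s [g Pg eg]]; first by exists f.
  have [h Ph eh] := Pp _ i Pg; exists h => // x Ux.
  rewrite -eh //=; apply: near_eq_derive.
  by apply: filterS (open_nbhs_nbhs (conj oU Ux)) => y; exact: eg.
move=> x Ux; apply: (@diff_near_eq _ _ g); last exact: Pd.
by apply: filterS (open_nbhs_nbhs (conj oU Ux)) => y; exact: eg.
Qed.
End Smooth.

(* Smooth n-dimensional manifold given by an indexed smooth atlas;            *)
(* [chart_map c] and [chart_inv c] are total functions, meaningful only on    *)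
(* [chart_dom c] and on its image.                                            *)
Record manifold (R : realType) (n : nat) := Manifold {
  pts :> topologicalType;
  chart : Type;
  chart_dom : chart -> set pts;
  chart_map : chart -> pts -> 'rV[R]_n;
  chart_inv : chart -> 'rV[R]_n -> pts;
  manifold_hausdorff : hausdorff_space pts;
  manifold_countable : @second_countable pts;
  chart_dom_open : forall c, open (chart_dom c);
  chart_dom_cover : forall p, exists c, chart_dom c p;
  chart_img_open : forall c, open (chart_map c @` chart_dom c);
  chart_mapK : forall c p, chart_dom c p -> chart_inv c (chart_map c p) = p;
  chart_map_cont : forall c p, chart_dom c p ->
    {for p, continuous (chart_map c)};
  chart_inv_cont : forall c p, chart_dom c p ->
    {for chart_map c p, continuous (chart_inv c)};
  transition_smooth : forall c c',
    smooth_on (chart_map c @` (chart_dom c `&` chart_dom c'))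
              (chart_map c' \o chart_inv c)
}.
Arguments chart_dom {R n} _ _ _.
Arguments chart_map {R n} _ _ _.
Arguments chart_inv {R n} _ _ _.

Section Fields.
Context {R : realType} {n : nat} (M : manifold R n).

Definition transition (c c' : chart M) : 'rV[R]_n -> 'rV[R]_n :=
  chart_map M c' \o chart_inv M c.

Definition smooth_fun (f : M -> R) : Prop :=
  forall c, smooth_on (chart_map M c @` chart_dom M c)
                      (f \o chart_inv M c : _ -> R^o).

(* A tensor field is given by its components in every chart c, as functions   *)
(* of the coordinates; the four predicates below state smoothness and the     *)
(* transformation law under a change of chart.                                *)
Definition vector_field (W : set M) (X : chart M -> 'rV[R]_n -> 'rV[R]_n) :
    Prop :=
  (forall c, smooth_on (chart_map M c @` (chart_dom M c `&` W)) (X c)) /\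
  (forall c c' p, W p -> chart_dom M c p -> chart_dom M c' p ->
     let x := chart_map M c p in
     X c' (chart_map M c' p) = 'd (transition c c') x (X c x)).

Definition affinor_field (A : chart M -> 'rV[R]_n -> 'M[R]_n) : Prop :=
  (forall c, smooth_on (chart_map M c @` chart_dom M c) (A c)) /\
  (forall c c' p v, chart_dom M c p -> chart_dom M c' p ->
     let J := 'd (transition c c') (chart_map M c p) in
     J v *m A c' (chart_map M c' p) = J (v *m A c (chart_map M c p))).

Definition form_field (a : chart M -> 'rV[R]_n -> 'cV[R]_n) : Prop :=
  (forall c, smooth_on (chart_map M c @` chart_dom M c) (a c)) /\
  (forall c c' p v, chart_dom M c p -> chart_dom M c' p ->
     let J := 'd (transition c c') (chart_map M c p) in
     ev (a c' (chart_map M c' p)) (J v) = ev (a c (chart_map M c p)) v).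

Definition metric_field (G : chart M -> 'rV[R]_n -> 'M[R]_n) : Prop :=
  [/\ (forall c, smooth_on (chart_map M c @` chart_dom M c) (G c)),
      (forall c c' p u v, chart_dom M c p -> chart_dom M c' p ->
         let J := 'd (transition c c') (chart_map M c p) in
         bil (G c' (chart_map M c' p)) (J u) (J v)
         = bil (G c (chart_map M c p)) u v),
      (forall c p u v, chart_dom M c p ->
         bil (G c (chart_map M c p)) u v = bil (G c (chart_map M c p)) v u) &
      (forall c p u, chart_dom M c p -> u != 0 ->
         0 < bil (G c (chart_map M c p)) u u)].

Record acm_structure := AcmStructure {
  phi : chart M -> 'rV[R]_n -> 'M[R]_n;
  xi : chart M -> 'rV[R]_n -> 'rV[R]_n;
  eta : chart M -> 'rV[R]_n -> 'cV[R]_n;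
  metr : chart M -> 'rV[R]_n -> 'M[R]_n;
  phi_field : affinor_field phi;
  xi_field : vector_field setT xi;
  eta_field : form_field eta;
  metr_field : metric_field metr;
  phi_sqr : forall c p v, chart_dom M c p -> let x := chart_map M c p in
    (v *m phi c x) *m phi c x = - v + ev (eta c x) v *: xi c x;
  eta_xi : forall c p, chart_dom M c p -> let x := chart_map M c p in
    ev (eta c x) (xi c x) = 1;
  metr_phi : forall c p u v, chart_dom M c p -> let x := chart_map M c p in
    bil (metr c x) (u *m phi c x) (v *m phi c x)
    = bil (metr c x) u v - ev (eta c x) u * ev (eta c x) v
}.

Implicit Types S : acm_structure.

Definition closed_form (a : chart M -> 'rV[R]_n -> 'cV[R]_n) : Prop :=
  forall c p u v, chart_dom M c p -> ext_d (a c) (chart_map M c p) u v = 0.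

(* d f /\ a = 0 *)
Definition dwedge_eq0 (f : M -> R) (a : chart M -> 'rV[R]_n -> 'cV[R]_n) :
    Prop :=
  forall c p u v, chart_dom M c p ->
    let x := chart_map M c p in
    let df w := 'd (f \o chart_inv M c : _ -> R^o) x w in
    df u * ev (a c x) v - df v * ev (a c x) u = 0.

Definition htens S (c : chart M) (x : 'rV[R]_n) : 'M[R]_n :=
  2^-1 *: lie_affinor (xi S c) (phi S c) x.

(* h' = h phi; affinors act on the right of row vectors. *)
Definition htens' S (c : chart M) (x : 'rV[R]_n) : 'M[R]_n :=
  phi S c x *m htens S c x.

(* X and Y range over the vector fields on arbitrary open subsets W of M,     *)
(* W = setT included.                                                         *)
Definition nullity S (kappa mu mu' : M -> R) : Prop :=
  forall (W : set M) (X Y : chart M -> 'rV[R]_n -> 'rV[R]_n),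
    open W -> vector_field W X -> vector_field W Y ->
  forall c p, W p -> chart_dom M c p ->
    let x := chart_map M c p in
    let Xp := X c x in let Yp := Y c x in
    let h := htens S c x in let h' := htens' S c x in
    let etaX := ev (eta S c x) Xp in let etaY := ev (eta S c x) Yp in
    curvature (metr S c) (X c) (Y c) (xi S c) x
    = kappa p *: (etaY *: Xp - etaX *: Yp)
      + mu p *: (etaY *: (Xp *m h) - etaX *: (Yp *m h))
      + mu' p *: (etaY *: (Xp *m h') - etaX *: (Yp *m h')).

End Fields.

Section Maps.
Context {R : realType} {m n : nat} {M : manifold R m} {N : manifold R n}.

Definition local_rep (F : M -> N) (c : chart M) (d : chart N) :
    'rV[R]_m -> 'rV[R]_n :=
  chart_map N d \o F \o chart_inv M c.

Definition smooth_map (W : set M) (F : M -> N) : Prop :=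
  (forall p, W p -> {for p, continuous F}) /\
  (forall c d,
     smooth_on (chart_map M c @` (chart_dom M c `&` W `&` F @^-1` chart_dom N d))
               (local_rep F c d)).

Definition tangent (F : M -> N) (c : chart M) (d : chart N) (p : M) :
    'rV[R]_m -> 'rV[R]_n :=
  'd (local_rep F c d) (chart_map M c p).

End Maps.

(* F preserves the structures on W: F_* phi = phi F_*, F_* xi = xi,           *)
(* eta = F^* eta, g = F^* g.                                                  *)
Definition preserves (R : realType) (n : nat) (M N : manifold R n)
    (S : acm_structure M) (T : acm_structure N) (W : set M) (F : M -> N) :
    Prop :=
  forall c d p, W p -> chart_dom M c p -> chart_dom N d (F p) ->
    let x := chart_map M c p in let y := chart_map N d (F p) in
    let J := tangent F c d p in
    [/\ forall v, J (v *m phi S c x) = J v *m phi T d y,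
        J (xi S c x) = xi T d y,
        forall v, ev (eta S c x) v = ev (eta T d y) (J v) &
        forall u v, bil (metr S c x) u v = bil (metr T d y) (J u) (J v)].

(* The diffeomorphism theta : U1 -> U2 and its inverse theta' are represented *)
(* by total maps, which are unconstrained outside of U1 and U2.               *)
Definition locally_isomorphic (R : realType) (n : nat) (M N : manifold R n)
    (S : acm_structure M) (T : acm_structure N) : Prop :=
  forall (x1 : M) (x2 : N),
  exists (U1 : set M) (U2 : set N) (theta : M -> N) (theta' : N -> M),
    [/\ [/\ open U1, open U2, U1 x1, U2 x2 & theta x1 = x2],
        theta @` U1 = U2,
        (forall p, U1 p -> theta' (theta p) = p),
        smooth_map U1 theta /\ smooth_map U2 theta' &
        preserves S T U1 theta].

Section ProductTopology.
Context (k : nat) (T : 'I_k -> topologicalType).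

Lemma prod_nbhsP (p : prod_topology T) (A : set (prod_topology T)) :
  nbhs p A <-> exists2 B : forall i, set (T i), (forall i, nbhs (p i) (B i))
    & [set q | forall i, B i (q i)] `<=` A.
Proof.
split; last first.
  case=> B nB sB; apply: filterS sB _.
  apply: (@filter_forall (prod_topology T) 'I_k (fun i q => B i (q i)) (nbhs p) _ _) => i.
  exact: (@proj_continuous _ T i p _ (nB i)).
pose F := filter_from [set B : forall i, set (T i) | forall i, nbhs (p i) (B i)]
   (fun B => [set q : prod_topology T | forall i, B i (q i)]).
have FF : Filter F.
  apply: filter_from_filter; first by exists (fun=> setT) => i; exact: filterT.
  move=> B C nB nC; exists (fun i => B i `&` C i); first by move=> i; exact: filterI.
  by move=> q H; split=> i; case: (H i).
have : F --> p.
  apply/cvg_sup => i B /=.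
  move=> [_ [[C oC <-] Cp] sC].
  exists (fun j => [set x | forall e : j = i, C (ecast j (T j) e x)]).
    move=> j /=; case: (eqVneq j i) => [e|/eqP ne].
      subst j. have nC : nbhs (p i) C by apply: open_nbhs_nbhs; split.
      apply: filterS nC => x Cx e.
      by rewrite (eq_axiomK e).
    by apply: filterS filterT => x _ e.
  move=> q /= H; apply: sC; exact: (H i erefl).
move=> /[apply] -[B nB sB]; by exists B.
Qed.

Lemma prod_second_countable : (forall i, @second_countable (T i)) ->
  @second_countable (prod_topology T).
Proof.
move=> H.
have H' i : exists b : nat -> set (T i), (forall n, open (b n)) /\
    forall (x : T i) A, nbhs x A -> exists n, b n x /\ b n `<=` A.
  case: (H i) => B cB [oB bB].
  case: (pselect (B !=set0)) => [[b0 Bb0]|B0].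
    have /countable_injP [f finj] := cB.
    pose g n := xget b0 (B `&` [set b | f b = n]).
    have gB n : B (g n).
      by rewrite /g; case: xgetP => [_ -> [] //|_].
    exists g; split; first by move=> n; exact: (oB _ (gB n)).
    move=> x A /(bB x) [U [BU Ux] sU]; exists (f U).
    suff -> : g (f U) = U by [].
    rewrite /g; case: xgetP => [b -> [Bb /= e]|/(_ U)]; last by case.
    by apply: finj => //; rewrite inE.
  exists (fun=> set0); split; first by move=> _; exact: open0.
  move=> x A /(bB x) [U [BU Ux] sU]; case: B0; by exists U.
pose b i := projT1 (cid (H' i)).
have Hb i : _ := projT2 (cid (H' i)); rewrite -/(b _) in Hb.
exists (range (fun f : {ffun 'I_k -> nat} => [set q : prod_topology T | forall i, b i (f i) (q i)])).
  apply: (sub_countable _ (countableP [set: {ffun 'I_k -> nat}])).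
  exact: card_image_le.
split.
  move=> _ [f _ <-]; rewrite openE => q /= Hq; apply/prod_nbhsP.
  exists (fun i => b i (f i)) => // i; apply: open_nbhs_nbhs; split=> //.
  exact: (Hb i).1.
move=> q A /prod_nbhsP [B nB sB].
have /choice [f Hf] : forall i, exists n, b i n (q i) /\ b i n `<=` B i.
  by move=> i; apply: (Hb i).2.
exists [set q : prod_topology T | forall i, b i (finfun f i) (q i)].
  split; first by exists (finfun f).
  by move=> i; rewrite ffunE; case: (Hf i).
by move=> r /= Hr; apply: sB => i; case: (Hf i) => _; apply; move: (Hr i); rewrite ffunE.
Qed.
End ProductTopology.

(* Coordinates on the product of k manifolds of dimension n are the           *)
(* concatenation of k blocks of length n.  In product charts the tangent map  *)
(* of the i-th projection is v |-> v *m blk i, and u |-> u *m (blk i)^T is    *)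
(* the lift of tangent vectors of the i-th factor to D_i.                     *)
Definition blk {R : realType} {k n : nat} (i : 'I_k) : 'M[R]_(k * n, n) :=
  \matrix_(a, b) (a == mxvec_index i b)%:R.

Section Blocks.
Context {R : realType}.

Lemma rV_linear_continuous n (V : normedModType R) (f : {linear 'rV[R]_n -> V}) :
  continuous f.
Proof.
move=> x; apply: differentiable_continuous.
have -> : (f : _ -> V) = \sum_(j < n) (fun y : 'rV[R]_n => y 0 j *: f (delta_mx 0 j)).
  apply/funext => y; rewrite fct_sumE {1}(row_sum_delta y) linear_sum.
  by apply: eq_bigr => j _; rewrite linearZ.
apply: differentiable_sum => j.
by apply: differentiableZl; exact: differentiable_coord.
Qed.

Lemma mulmxr_is_diff n m (A : 'M[R]_(n, m)) (x : 'rV[R]_n) :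
  is_diff x (mulmxr A : 'rV[R]_n -> 'rV[R]_m) (mulmxr A : 'rV[R]_n -> 'rV[R]_m).
Proof.
have c : continuous (mulmxr A : 'rV[R]_n -> 'rV[R]_m) by exact: rV_linear_continuous.
by apply: DiffDef; [exact: linear_differentiable | rewrite diff_lin].
Qed.

Context {k n : nat}.
Local Notation blk := (@blk R k n).

Lemma mxvec_index_inj i j (b c : 'I_n) :
  (@mxvec_index k n i b == mxvec_index j c) = (i == j) && (b == c).
Proof.
apply/eqP/andP => [|[/eqP-> /eqP->] //].
by move=> /cast_ord_inj /enum_rank_inj [-> ->].
Qed.

Lemma blkE i (x : 'rV[R]_(k * n)) b : (x *m blk i) 0 b = x 0 (mxvec_index i b).
Proof.
rewrite mxE (bigD1 (mxvec_index i b)) //= mxE eqxx mulr1 big1 ?addr0 // => a /negbTE ne.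
by rewrite mxE ne mulr0.
Qed.

Lemma blktrE i (u : 'rV[R]_n) j b :
  (u *m (blk i)^T) 0 (mxvec_index j b) = if i == j then u 0 b else 0.
Proof.
rewrite mxE (bigD1 b) //= big1 => [|c /negbTE ne].
  by rewrite !mxE mxvec_index_inj eqxx andbT eq_sym addr0; case: eqP; rewrite ?mulr1 ?mulr0.
by rewrite !mxE mxvec_index_inj [b == c]eq_sym ne andbF mulr0.
Qed.

Lemma blk_tr i j (u : 'rV[R]_n) : u *m (blk i)^T *m blk j = if i == j then u else 0.
Proof. by apply/rowP => b; rewrite blkE blktrE; case: eqP => //; rewrite mxE. Qed.

Lemma blk_sumE (u : 'I_k -> 'rV[R]_n) j :
  (\sum_i u i *m (blk i)^T) *m blk j = u j.
Proof.
rewrite mulmx_suml (bigD1 j) //= blk_tr eqxx big1 ?addr0 // => i /negbTE ne.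
by rewrite blk_tr ne.
Qed.

Lemma blk_delta i j (b : 'I_n) :
  ebase (mxvec_index j b) *m blk i = if j == i then ebase b else 0 :> 'rV[R]_n.
Proof.
apply/rowP => c; rewrite blkE mxE eqxx /= mxvec_index_inj [i == j]eq_sym.
by case: (j == i); rewrite !mxE ?eqxx.
Qed.

Lemma smooth_blocks (U : 'I_k -> set 'rV[R]_n) (f : 'I_k -> 'rV[R]_n -> 'rV[R]_n) :
  (forall i, open (U i)) -> (forall i, smooth_on (U i) (f i)) ->
  smooth_on [set x : 'rV[R]_(k * n) | forall i, U i (x *m blk i)]
    (fun x => \sum_i f i (x *m blk i) *m (blk i)^T).
Proof.
move=> oU sf.
set W := [set x | _].
have oW : open W.
  rewrite openE => x Wx.
  apply: (@filter_forall 'rV[R]_(k * n) 'I_k (fun i y => U i (y *m blk i)) (nbhs x) _ _) => i.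
  have c : {for x, continuous (mulmxr (blk i) : 'rV[R]_(k * n) -> 'rV[R]_n)}.
    exact: rV_linear_continuous.
  by apply: (c (U i)); apply: open_nbhs_nbhs; split => //; exact: Wx.
have D (g : 'I_k -> 'rV[R]_n -> 'rV[R]_n) : (forall i, smooth_on (U i) (g i)) -> forall x, W x ->
    is_diff x (fun x => \sum_i g i (x *m blk i) *m (blk i)^T)
      (fun v => \sum_i 'd (g i) (x *m blk i) (v *m blk i) *m (blk i)^T).
  move=> sg x Wx.
  have Di i : is_diff x (mulmxr (blk i)^T \o (g i \o mulmxr (blk i)))
      (fun v => 'd (g i) (x *m blk i) (v *m blk i) *m (blk i)^T).
    have dg : is_diff (mulmxr (blk i) x) (g i) ('d (g i) (x *m blk i)).
      by apply: DiffDef => //; apply: (sg i [::]); exact: Wx.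
    have d1 := mulmxr_is_diff (blk i) x.
    have d2 := is_diff_comp d1 dg.
    have d3 := mulmxr_is_diff (blk i)^T ((g i \o mulmxr (blk i)) x).
    exact: is_diff_comp d2 d3.
  have -> : (fun x => \sum_i g i (x *m blk i) *m (blk i)^T)
     = \sum_i (mulmxr (blk i)^T \o (g i \o mulmxr (blk i))).
    by apply/funext => y; rewrite fct_sumE.
  have -> : (fun v => \sum_i 'd (g i) (x *m blk i) (v *m blk i) *m (blk i)^T)
     = \sum_i (fun v => 'd (g i) (x *m blk i) (v *m blk i) *m (blk i)^T).
    by apply/funext => y; rewrite fct_sumE.
  elim: (index_enum _) => [|i r IH]; first by rewrite !big_nil; exact: is_diff_cst.
  by rewrite !big_cons; exact: is_diffD.
pose P (F : 'rV[R]_(k * n) -> 'rV[R]_(k * n)) := exists2 g : 'I_k -> 'rV[R]_n -> 'rV[R]_n,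
  (forall i, smooth_on (U i) (g i)) & F = (fun x => \sum_i g i (x *m blk i) *m (blk i)^T).
apply: (@smooth_ind _ _ _ W P) => //; last by exists f.
  by move=> _ [g sg ->] x Wx; case: (D g sg x Wx).
move=> _ a [g sg ->]; case/mxvec_indexP: a => j b.
pose g' i := if j == i then (fun x => 'D_(ebase b) (g i) x) else cst 0.
exists (fun x => \sum_i g' i (x *m blk i) *m (blk i)^T).
  exists g' => // i; rewrite /g'; case: eqP => _; first exact: smooth_partial.
  move=> s x Ux. suff -> : partials s (cst 0) = (cst 0 : 'rV[R]_n -> 'rV[R]_n) by [].
  elim: s => //= c s ->; apply/funext => y; exact: derive_cst.
move=> x Wx; have [df dE] := D g sg x Wx.
rewrite deriveE // dE; apply: eq_bigr => i _; rewrite blk_delta /g'.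
case: eqP => _; last by rewrite linear0.
by rewrite deriveE //; apply: (sg i [::]); exact: Wx.
Qed.
End Blocks.

Lemma open_overlap (R : realType) n (M : manifold R n) (c c' : chart M) :
  open (chart_map M c @` (chart_dom M c `&` chart_dom M c')).
Proof.
rewrite openE => _ [p [dp dp'] <-].
have n1 : nbhs (chart_map M c p) (chart_map M c @` chart_dom M c).
  by apply: open_nbhs_nbhs; split; [exact: chart_img_open | exists p].
have n2 : nbhs (chart_map M c p) (chart_inv M c @^-1` chart_dom M c').
  apply: (chart_inv_cont dp); rewrite chart_mapK //.
  by apply: open_nbhs_nbhs; split; [exact: chart_dom_open|].
apply: filterS (filterI n1 n2) => x [[q dq <-]] /=; rewrite chart_mapK // => dq'.
by exists q.
Qed.

Section Prod.
Context (R : realType) (k n : nat) (C : 'I_k -> manifold R n).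
Local Notation T := (prod_topology (fun i => C i)).
Definition prod_chart := forall i, chart (C i).

Definition prod_dom (c : prod_chart) : set T :=
  [set p | forall i, chart_dom (C i) (c i) (p i)].

Definition prod_coord (c : prod_chart) (p : T) : 'rV[R]_(k * n) :=
  \sum_i chart_map (C i) (c i) (p i) *m (blk i)^T.

Definition prod_param (c : prod_chart) (x : 'rV[R]_(k * n)) : T :=
  fun i => chart_inv (C i) (c i) (x *m blk i).

Lemma prod_coordE (c : prod_chart) p i :
  prod_coord c p *m blk i = chart_map (C i) (c i) (p i).
Proof. exact: blk_sumE. Qed.

Lemma blk_inj (x y : 'rV[R]_(k * n)) : (forall i, x *m blk i = y *m blk i) -> x = y.
Proof.
move=> H; apply/rowP => a; case/mxvec_indexP: a => i b.
by have /rowP /(_ b) := H i; rewrite !blkE.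
Qed.

Lemma prod_img c : prod_coord c @` prod_dom c =
  [set x | forall i,
     (chart_map (C i) (c i) @` chart_dom (C i) (c i)) (x *m blk i)].
Proof.
apply/seteqP; split => [_ [p dp <-] i|x Hx]; first by rewrite prod_coordE; exists (p i).
pose p : T := fun i => projT1 (cid2 (Hx i)).
have Hp i : chart_dom (C i) (c i) (p i) /\ chart_map (C i) (c i) (p i) = x *m blk i.
  by rewrite /p; case: (cid2 (Hx i)).
exists p; first by move=> i; case: (Hp i).
by apply: blk_inj => i; rewrite prod_coordE; case: (Hp i).
Qed.

Lemma open_blk (U : 'I_k -> set 'rV[R]_n) : (forall i, open (U i)) ->
  open [set x : 'rV[R]_(k * n) | forall i, U i (x *m blk i)].
Proof.
move=> oU; rewrite openE => x Wx.
apply: (@filter_forall 'rV[R]_(k * n) 'I_k (fun i y => U i (y *m blk i)) (nbhs x) _ _) => i.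
have c : {for x, continuous (mulmxr (blk i) : 'rV[R]_(k * n) -> 'rV[R]_n)}.
  exact: rV_linear_continuous.
by apply: (c (U i)); apply: open_nbhs_nbhs; split => //; exact: Wx.
Qed.

Lemma prod_hausdorff : hausdorff_space T.
Proof. by move=> p q; apply: hausdorff_product => i; exact: manifold_hausdorff. Qed.

Lemma prod_countable : @second_countable T.
Proof. by apply: prod_second_countable => i; exact: manifold_countable. Qed.

Lemma prod_dom_open c : open (prod_dom c).
Proof.
rewrite openE => p dp; apply/prod_nbhsP; exists (fun i => chart_dom (C i) (c i)) => // i.
by apply: open_nbhs_nbhs; split; [exact: chart_dom_open|exact: dp].
Qed.

Lemma prod_dom_cover p : exists c, prod_dom c p.
Proof.
exists (fun i => projT1 (cid (chart_dom_cover (p i)))) => i.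
exact: projT2 (cid (chart_dom_cover (p i))).
Qed.

Lemma prod_img_open c : open (prod_coord c @` prod_dom c).
Proof.
rewrite prod_img.
apply: (open_blk (U := fun i => chart_map (C i) (c i) @` chart_dom (C i) (c i))).
move=> i.
exact: chart_img_open.
Qed.

Lemma prod_coordK c p : prod_dom c p -> prod_param c (prod_coord c p) = p.
Proof.
move=> dp; apply: functional_extensionality_dep => i; rewrite /prod_param prod_coordE.
by rewrite chart_mapK.
Qed.

Lemma prod_coord_cont c p : prod_dom c p -> {for p, continuous (prod_coord c)}.
Proof.
move=> dp; rewrite /prod_coord; elim: (index_enum _) => [|i r IH].
  have -> : (fun q : T => \sum_(i <- [::]) chart_map (C i) (c i) (q i) *m (blk i)^T) = cst 0.
    by apply/funext => q; rewrite big_nil.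
  exact: cst_continuous.
have -> : (fun q : T => \sum_(j <- i :: r) chart_map (C j) (c j) (q j) *m (blk j)^T)
  = (fun q : T => chart_map (C i) (c i) (q i) *m (blk i)^T)
   + (fun q : T => \sum_(i <- r) chart_map (C i) (c i) (q i) *m (blk i)^T).
  by apply/funext => q; rewrite big_cons.
apply: cvgD IH.
have cb : continuous (mulmxr (blk i)^T : 'rV[R]_n -> 'rV[R]_(k * n)).
  exact: rV_linear_continuous.
have cp : {for p, continuous (fun q : T => q i)}.
  exact: (@proj_continuous _ (fun i => C i) i p).
have cc : {for p, continuous (chart_map (C i) (c i) \o (fun q : T => q i))}.
  by apply: continuous_comp => //; exact: chart_map_cont.
exact: (continuous_comp cc (cb _)).
Qed.

Lemma prod_param_cont c p : prod_dom c p ->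
  {for prod_coord c p, continuous (prod_param c)}.
Proof.
move=> dp A; rewrite /= => /prod_nbhsP [B nB sB].
apply: filterS (_ : (\forall x \near prod_coord c p, forall i, B i (prod_param c x i))).
  by move=> x; exact: sB.
apply: (@filter_forall 'rV[R]_(k * n) 'I_k (fun i x => B i (prod_param c x i)) (nbhs _) _ _) => i.
have cb : continuous (mulmxr (blk i) : 'rV[R]_(k * n) -> 'rV[R]_n).
  exact: rV_linear_continuous.
apply: (cb (prod_coord c p) (chart_inv (C i) (c i) @^-1` B i)); rewrite /= prod_coordE.
by apply: (chart_inv_cont (dp i)); rewrite chart_mapK //; move: (nB i); rewrite prod_coordK.
Qed.

Lemma prod_transition_smooth c c' :
  smooth_on (prod_coord c @` (prod_dom c `&` prod_dom c'))
            (prod_coord c' \o prod_param c).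
Proof.
have := @smooth_blocks R k n
  (fun i => chart_map (C i) (c i) @`
              (chart_dom (C i) (c i) `&` chart_dom (C i) (c' i)))
  (fun i => chart_map (C i) (c' i) \o chart_inv (C i) (c i)).
move=> /(_ _ _) H s x [p [dp dp'] <-].
apply: H.
- by move=> i; exact: open_overlap.
- by move=> i; exact: transition_smooth.
- by move=> i; rewrite prod_coordE; exists (p i).
Qed.

Definition prod_manifold : manifold R (k * n) :=
  Manifold prod_hausdorff prod_countable prod_dom_open prod_dom_cover
    prod_img_open prod_coordK prod_coord_cont prod_param_cont
    prod_transition_smooth.

End Prod.

Section Integral.
Context {R : realType} {m n : nat} {M : manifold R n}.

(* Connected integral submanifolds, as injective immersions, of a             *)
(* distribution given by its fibres in coordinates.  A maximal one is not     *)
(* properly contained in another one.                                         *)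
Definition integral_submanifold (D : chart M -> 'rV[R]_n -> set 'rV[R]_n)
    (N : manifold R m) (iota : N -> M) : Prop :=
  [/\ [set: N] !=set0, connected [set: N], injective iota,
      smooth_map setT iota &
      forall c d q, chart_dom N c q -> chart_dom M d (iota q) ->
        injective (tangent iota c d q) /\
        range (tangent iota c d q) = D d (chart_map M d (iota q))].

Definition maximal_integral_submanifold
    (D : chart M -> 'rV[R]_n -> set 'rV[R]_n) (N : manifold R m)
    (iota : N -> M) : Prop :=
  integral_submanifold D iota /\
  (forall (N' : manifold R m) (iota' : N' -> M),
     integral_submanifold D iota' ->
     range iota `<=` range iota' -> range iota' `<=` range iota).

End Integral.

Record cell (R : realType) := Cell {
  cell_man :> manifold R 3;
  cell_acm : acm_structure cell_man;
  cell_closed : closed_form (eta cell_acm)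
}.

Section SewedCells.
Context {R : realType} {k : nat} (C : 'I_k -> cell R).

Definition cell_product : manifold R (k * 3) :=
  prod_manifold (fun i => cell_man (C i)).

Implicit Types (c : chart cell_product) (x : 'rV[R]_(k * 3)).

Definition phi_bar (i : 'I_k) c x : 'M[R]_(k * 3) :=
  blk i *m phi (cell_acm (C i)) (c i) (x *m blk i) *m (blk i)^T.

Definition xi_bar (i : 'I_k) c x : 'rV[R]_(k * 3) :=
  xi (cell_acm (C i)) (c i) (x *m blk i) *m (blk i)^T.

Definition eta_bar (i : 'I_k) c x : 'cV[R]_(k * 3) :=
  blk i *m eta (cell_acm (C i)) (c i) (x *m blk i).

Definition f_total c x : 'M[R]_(k * 3) := \sum_i phi_bar i c x.

Definition g_total c x : 'M[R]_(k * 3) :=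
  \sum_i blk i *m metr (cell_acm (C i)) (c i) (x *m blk i) *m (blk i)^T.

Definition xi_total c x : 'rV[R]_(k * 3) :=
  (Num.sqrt k%:R)^-1 *: \sum_i xi_bar i c x.

Definition sewing_distribution c x : set 'rV[R]_(k * 3) :=
  [set w | exists v a, w = v *m f_total c x + a *: xi_total c x].

(* N = C_1 - ... - C_k with inclusion iota and structure S; dim N = 2k + 1. *)
Definition sewed_cells (hk : (1 < k)%N) (N : manifold R (k.*2).+1)
    (iota : N -> cell_product) (S : acm_structure N) : Prop :=
  maximal_integral_submanifold sewing_distribution iota /\
  (forall (c : chart N) (d : chart cell_product) q,
     chart_dom N c q -> chart_dom cell_product d (iota q) ->
     let x := chart_map N c q in let y := chart_map cell_product d (iota q) in
     let J := tangent iota c d q in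
     [/\ forall v, J (v *m phi S c x) = J v *m f_total d y,
         J (xi S c x) = xi_total d y,
         forall v, ev (eta S c x) v
           = Num.sqrt k%:R * ev (eta_bar (Ordinal (ltnW hk)) d y) (J v) &
         forall u v, bil (metr S c x) u v = bil (g_total d y) (J u) (J v)]).

End SewedCells.

(* Main.v *)
(* The cells are pairwise locally isomorphic at all pairs of points, so a     *)
(* triple (kappa, mu, mu') satisfying the nullity condition at one point of   *)
(* one cell satisfies it, as constants, at all points of all cells.  Since    *)
(* phi_i, eta_i and g_i of the cells induce phi, eta and g on N while         *)
(* iota_* xi = k^(-1/2) sum_i xi_i, and nabla xi_i takes its values in        *)
(* Ker eta_i, the field k^(-1/2) sum_i nabla^i xi_i is tangent to N and       *)
(* equals nabla xi.  Differentiating once more, R(X, Y) xi is the tangential  *)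
(* part of k^(-1/2) sum_i R_i(X_i, Y_i) xi_i.  With eta_i(X_i) = k^(-1/2)     *)
(* eta(X) and h = k^(-1/2) sum_i h_i this yields the nullity condition with   *)
(* (kappa / k, mu / sqrt k, mu' / sqrt k).  Uniqueness holds because h and h' *)
(* anticommute with phi on Ker eta while the identity commutes with it.       *)
Require Import Defs.
From mathcomp Require Import all_boot all_order all_algebra.
From mathcomp Require Import all_classical all_reals all_analysis.
From mathcomp Require Import ring lra.
Set Implicit Arguments.
Unset Strict Implicit.
Unset Printing Implicit Defensive.
Import Order.TTheory GRing.Theory Num.Theory numFieldNormedType.Exports.
Local Open Scope classical_set_scope.
Local Open Scope ring_scope.

(** * Derivatives of matrix-valued functions *)

(** The proof rests on one transport principle for pointwise nullity conditions. Curvature is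
    tensorial, so the nullity condition is an algebraic identity [nullity_at] at each point
    ([nullity_pointwise]). Consider maps F_i from M to almost contact metric manifolds N_i such that
    g is the sum of the pulled back g_i, phi is F_i-related to phi_i, xi is F_i-related to s xi_i,
    eta_i pulls back to s eta, and every family of vectors w_i in Ker eta_i comes from one tangent
    vector of M. By Koszul's formula the Levi-Civita connection of M is the tangential part of that
    of the product ([christoffel2_pullback]). As xi_i has unit length, nabla xi_i takes values in
    Ker eta_i; hence s sum_i nabla xi_i is already tangent to M and equals nabla xi
    ([conn_pullback]). Differentiating this equality gives R(X, Y) xi ([curv_pullback]), naturality
    of the Lie derivative gives h ([htens_pullback]), and a triple (k, m, m') valid at all the image
    points becomes (s^2 k, s m, s m') on M ([nullity_at_pullback]).

    The principle is used twice. For a single local isomorphism and s = 1 ([nullity_at_iso]) it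
    carries a triple from one point of a cell to every point of every other cell, and through a
    second cell back to every point of the first; so one constant triple serves all cells. For the
    components of the inclusion of N and s = 1 / sqrt k ([sewed_nullity_at]) it yields constant
    coefficients on N, whose differentials vanish.

    Uniqueness is linear algebra on Ker eta ([nullity_at_unique]). Closedness of the eta_i makes h
    anticommute with phi, which separates the kappa-term from the other two; these are then
    determined wherever h is nonzero. *)

Section MatrixCalculus.
Context {R : realType} {V : normedModType R}.
Implicit Types (x v : V).

Lemma differentiable_mxP m n (f : V -> 'M[R]_(m, n)) x :
  differentiable f x <-> forall i j, differentiable (fun y => f y i j) x.
Proof.
split=> [df i j|df].
  exact: (differentiable_comp df (differentiable_coord (f x) i j)).
have -> : f = \sum_(i < m) \sum_(j < n) (fun y => f y i j *: delta_mx i j).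
  apply/funext => y; rewrite fct_sumE {1}[f y]matrix_sum_delta.
  by apply: eq_bigr => i _; rewrite fct_sumE.
by apply: differentiable_sum => i; apply: differentiable_sum => j; apply: differentiableZl.
Qed.

Lemma derive_mxE m n (f : V -> 'M[R]_(m, n)) x v i j : differentiable f x ->
  'D_v (fun y => f y i j) x = ('D_v f x) i j.
Proof. by move=> df; rewrite derive_mx ?mxE //; exact: diff_derivable. Qed.

Lemma derive_chain (W U : normedModType R) (f : V -> W) (g : W -> U) x v :
  differentiable f x -> differentiable g (f x) ->
  'D_v (g \o f) x = 'D_('D_v f x) g (f x).
Proof.
move=> df dg; rewrite !deriveE //; last exact: differentiable_comp.
by rewrite diff_comp.
Qed.

Lemma deriveDl (W : normedModType R) (f : V -> W) x u v : differentiable f x ->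
  'D_(u + v) f x = 'D_u f x + 'D_v f x.
Proof. by move=> df; rewrite !deriveE // linearD. Qed.

Lemma deriveZl (W : normedModType R) (f : V -> W) x a v : differentiable f x ->
  'D_(a *: v) f x = a *: 'D_v f x.
Proof. by move=> df; rewrite !deriveE // linearZ. Qed.

Lemma differentiable_big (W : normedModType R) (I : Type) (r : seq I) (P : pred I)
    (f : I -> V -> W) x :
  (forall i, differentiable (f i) x) ->
  differentiable (fun y => \sum_(i <- r | P i) f i y) x.
Proof.
move=> df; have -> : (fun y => \sum_(i <- r | P i) f i y) = \sum_(i <- r | P i) f i.
  by apply/funext => y; rewrite fct_sumE.
elim: r => [|i r IH]; first by rewrite big_nil; exact: differentiable_cst.
by rewrite big_cons; case: (P i) => //; exact: differentiableD.
Qed.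

Lemma derive_big (W : normedModType R) (I : Type) (r : seq I) (P : pred I)
    (f : I -> V -> W) x v :
  (forall i, differentiable (f i) x) ->
  'D_v (fun y => \sum_(i <- r | P i) f i y) x = \sum_(i <- r | P i) 'D_v (f i) x.
Proof.
move=> df; elim: r => [|i r IH].
  have -> : (fun y => \sum_(i <- [::] | P i) f i y) = cst 0.
    by apply/funext => y; rewrite big_nil.
  by rewrite big_nil derive_cst.
have -> : (fun y => \sum_(i <- i :: r | P i) f i y) =
   (if P i then f i + (fun y => \sum_(i <- r | P i) f i y)
    else (fun y => \sum_(i <- r | P i) f i y)).
  by apply/funext => y; rewrite big_cons; case: (P i).
rewrite big_cons; case: (P i) => //.
by rewrite deriveD ?IH //; apply: diff_derivable => //; exact: differentiable_big.
Qed.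

Lemma differentiable_mulmx m n p (f : V -> 'M[R]_(m, n)) (g : V -> 'M[R]_(n, p)) x :
  differentiable f x -> differentiable g x -> differentiable (fun y => f y *m g y) x.
Proof.
move=> /differentiable_mxP df /differentiable_mxP dg; apply/differentiable_mxP => i j.
have -> : (fun y => (f y *m g y) i j) = (fun y => \sum_k f y i k * g y k j).
  by apply/funext => y; rewrite mxE.
by apply: differentiable_big => k; exact: differentiableM.
Qed.

Lemma derive_mulmx m n p (f : V -> 'M[R]_(m, n)) (g : V -> 'M[R]_(n, p)) x v :
  differentiable f x -> differentiable g x ->
  'D_v (fun y => f y *m g y) x = 'D_v f x *m g x + f x *m 'D_v g x.
Proof.
move=> df dg; have dfg := differentiable_mulmx df dg.
have df' := (differentiable_mxP _ _).1 df; have dg' := (differentiable_mxP _ _).1 dg.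
apply/matrixP => i j; rewrite -derive_mxE //.
have -> : (fun y => (f y *m g y) i j) = (fun y => \sum_k f y i k * g y k j).
  by apply/funext => y; rewrite mxE.
rewrite derive_big; last by move=> k; exact: differentiableM.
rewrite !mxE -big_split /=; apply: eq_bigr => k _.
have dfk : derivable (fun y => f y i k) x v by apply: diff_derivable.
have dgk : derivable (fun y => g y k j) x v by apply: diff_derivable.
have -> : 'D_v (fun y => f y i k * g y k j) x
   = f x i k *: 'D_v (fun y => g y k j) x + g x k j *: 'D_v (fun y => f y i k) x.
  exact: (deriveM dfk dgk).
by rewrite !derive_mxE // addrC; congr (_ + _); exact: mulrC.
Qed.

Lemma differentiable_mulmxl m n p (A : 'M[R]_(m, n)) (g : V -> 'M[R]_(n, p)) x :
  differentiable g x -> differentiable (fun y => A *m g y) x.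
Proof.
exact: (@differentiable_mulmx _ _ _ (fun=> A) g x (differentiable_cst A x)).
Qed.

Lemma derive_mulmxl m n p (A : 'M[R]_(m, n)) (g : V -> 'M[R]_(n, p)) x v :
  differentiable g x -> 'D_v (fun y => A *m g y) x = A *m 'D_v g x.
Proof.
move=> dg; have := @derive_mulmx _ _ _ (fun=> A) g x v (differentiable_cst A x) dg.
by move=> ->; rewrite derive_cst mul0mx add0r.
Qed.

Lemma differentiable_scale n (W := 'rV[R]_n) (a : V -> R) (f : V -> W) x :
  differentiable a x -> differentiable f x -> differentiable (fun y => a y *: f y) x.
Proof.
move=> da /differentiable_mxP df; apply/differentiable_mxP => i j.
have -> : (fun y => (a y *: f y) i j) = (fun y => a y * f y i j).
  by apply/funext => y; rewrite mxE.
exact: differentiableM.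
Qed.

Lemma differentiable_tr m n (f : V -> 'M[R]_(m, n)) x :
  differentiable f x -> differentiable (fun y => (f y)^T) x.
Proof.
move=> /differentiable_mxP df; apply/differentiable_mxP => i j.
have -> : (fun y => (f y)^T i j) = (fun y => f y j i) by apply/funext => y; rewrite mxE.
exact: df.
Qed.

Lemma differentiable_prod (I : Type) (r : seq I) (f : I -> V -> R) x :
  (forall i, differentiable (f i) x) -> differentiable (fun y => \prod_(i <- r) f i y) x.
Proof.
move=> df; elim: r => [|i r IH].
  have -> : (fun y => \prod_(i <- [::]) f i y) = cst 1 by apply/funext => y; rewrite big_nil.
  exact: differentiable_cst.
have -> : (fun y => \prod_(j <- i :: r) f j y) = (fun y => f i y * \prod_(j <- r) f j y).
  by apply/funext => y; rewrite big_cons.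
exact: differentiableM.
Qed.

Lemma differentiable_det n (f : V -> 'M[R]_n) x :
  differentiable f x -> differentiable (fun y => \det (f y)) x.
Proof.
move=> /differentiable_mxP df; apply: differentiable_big => s.
by apply: differentiableM; [exact: differentiable_cst|exact: differentiable_prod].
Qed.

End MatrixCalculus.

Section Inverse.
Context {R : realType} {m : nat}.
Implicit Types (x v : 'rV[R]_m).

(** Near x the inverse is the adjugate divided by the determinant, and both are polynomial in the
    entries. *)
Lemma differentiable_invmx n (f : 'rV[R]_m -> 'M[R]_n) x :
  (\forall y \near x, f y \in unitmx) -> differentiable f x ->
  differentiable (fun y => invmx (f y)) x.
Proof.
move=> uf df.
apply: (@diff_near_eq _ _ _ _ (fun y => (\det (f y))^-1 *: \adj (f y))).
  by apply: filterS uf => y uy; rewrite /invmx uy.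
apply/differentiable_mxP => i j.
have -> : (fun y => ((\det (f y))^-1 *: \adj (f y)) i j)
  = (fun y => (\det (f y))^-1 * \adj (f y) i j).
  by apply/funext => y; rewrite mxE.
apply: differentiableM.
  apply: differentiableV; first exact: differentiable_det.
  by move: (nbhs_singleton uf); rewrite unitmxE unitfE.
have -> : (fun y => \adj (f y) i j)
  = (fun y => (-1) ^+ (j + i) * \det (row' j (col' i (f y)))).
  by apply/funext => y; rewrite mxE.
apply: differentiableM; first exact: differentiable_cst.
apply: differentiable_det; apply/differentiable_mxP => a b.
have -> : (fun y => row' j (col' i (f y)) a b) = (fun y => f y (lift j a) (lift i b)).
  by apply/funext => y; rewrite !mxE.
exact: (differentiable_mxP _ _).1 df _ _.
Qed.

End Inverse.

(** * Symmetry of second derivatives and smooth composition *)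

Section Schwarz.
Context {R : realType} {V : normedModType R}.
Implicit Types (f : V -> R) (x u v : V).

Lemma is_derive_line f u w (s : R) : differentiable f (s *: u + w) ->
  is_derive s 1 (fun t : R => f (t *: u + w)) ('D_u f (s *: u + w)).
Proof.
move=> df.
have dl : is_diff s (fun t : R => t *: u + w) ( *:%R ^~ u).
  have -> : (fun t : R => t *: u + w) = *:%R ^~ u + cst w by [].
  by apply: is_diff_eq; rewrite addr0.
have dl1 : 'D_1 (fun t : R => t *: u + w) s = u.
  by rewrite deriveE // diff_val scale1r.
apply: DeriveDef; first by apply: diff_derivable; exact: differentiable_comp.
have := @derive_chain R R^o V R^o (fun t : R => t *: u + w) f s 1.
by rewrite dl1; apply.
Qed.

(** The mean value theorem in direction u turns the mixed difference into a difference of values of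
    ['D_u f], which differentiability of ['D_u f] at x alone suffices to estimate. The mixed
    difference is symmetric in u and v, which is what [derive_sym_real] exploits. *)
Lemma second_difference f x u v : (\forall y \near x, differentiable f y) ->
  differentiable ('D_u f) x -> forall e : R, 0 < e ->
  \forall h \near 0^'+,
   `|f (h *: u + (h *: v + x)) - f (h *: u + x) - f (h *: v + x) + f x
     - h ^+ 2 * 'D_v ('D_u f) x| <= e * h ^+ 2.
Proof.
move=> nf dp e e0; set p := 'D_u f.
(* All points c u + t v with 0 <= c, t <= h have norm at most h K; the summand 1 keeps K positive
   when u and v vanish. With precision e / (2 K), each of the two linearization errors is at most e
   / 2 * h. *)
pose K := `|u| + `|v| + 1.
have K0 : 0 < K by rewrite ltr_wpDl // addr_ge0.
have [_ /eqaddoP H] := (diff_locallyP x p).1 dp.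
have eK : 0 < e / (2 * K) by rewrite divr_gt0 // mulr_gt0.
have nf0 : \forall w \near (0 : V), differentiable f (w + x).
  by move: nf; rewrite (near_shift 0) subr0.
have [d /= d0 Hd] := (nbhs_ballP _ _).1 (filterI nf0 (H _ eK)).
near=> h.
have h0 : 0 < h by near: h; exact: nbhs_right_gt.
have hd : h * K < d.
  rewrite -ltr_pdivlMr //; near: h; apply: nbhs_right_lt; exact: divr_gt0.
have small (c t : R) : 0 <= c <= h -> 0 <= t <= h -> `|c *: u + t *: v| <= h * K.
  move=> /andP[c0 ch] /andP[t0 th].
  apply: (le_trans (ler_normD _ _)); rewrite !normrZ !ger0_norm // /K !mulrDr mulr1.
  rewrite ler_wpDr ?(ltW h0) //; apply: lerD; exact: ler_wpM2r.
have good (c t : R) : 0 <= c <= h -> 0 <= t <= h ->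
    differentiable f (c *: u + (t *: v + x)) /\
    `|p (c *: u + (t *: v + x)) - (p x + 'd p x (c *: u + t *: v))| <= e / 2 * h.
  move=> ch th; have sm := small _ _ ch th.
  have [] := Hd (c *: u + t *: v).
    by rewrite -ball_normE /= sub0r normrN; exact: le_lt_trans hd.
  rewrite addrA => df Hp; split=> //; apply: (le_trans Hp).
  apply: (le_trans (ler_wpM2l (ltW eK) sm)).
  by rewrite le_eqVlt; apply/orP; left; apply/eqP; field; rewrite gt_eqF.
(* The mixed difference is phi(h) - phi(0), hence h times [dphi] at an intermediate point c. *)
pose phi (t : R) := f (t *: u + (h *: v + x)) - f (t *: u + x).
pose dphi (t : R) := p (t *: u + (h *: v + x)) - p (t *: u + x).
have hh : 0 <= h <= h by rewrite lexx (ltW h0).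
have h00 : 0 <= (0 : R) <= h by rewrite lexx (ltW h0).
have Dphi t : t \in `[0, h] -> is_derive t 1 phi (dphi t).
  rewrite in_itv /= => th; apply: is_deriveB; apply: is_derive_line.
    by case: (good _ _ th hh).
  by have [] := good _ _ th h00; rewrite scale0r add0r.
have cphi : {within `[0, h], continuous phi}.
  apply: derivable_within_continuous => t th; by have [] := Dphi t th.
have Dphi' t : t \in `]0, h[ -> is_derive t 1 phi (dphi t).
  by move=> th; apply: Dphi; move: th; rewrite !in_itv /= => /andP[t0 th]; rewrite !ltW.
have [c] := MVT h0 Dphi' cphi; rewrite in_itv /= => /andP[c0 ch].
have cc : 0 <= c <= h by rewrite !ltW.
have [_ A] := good _ _ cc hh; have [_] := good _ _ cc h00.
rewrite scale0r add0r addr0 => B.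
rewrite /phi /dphi subr0 scale0r !add0r => E.
have -> : f (h *: u + (h *: v + x)) - f (h *: u + x) - f (h *: v + x) + f x
   = (p (c *: u + (h *: v + x)) - p (c *: u + x)) * h.
  by rewrite -E; ring.
have -> : 'D_v p x = 'd p x v by rewrite deriveE.
have dE : 'd p x (c *: u + h *: v) = c * 'd p x u + h * 'd p x v.
  by rewrite linearD !linearZ.
have dE' : 'd p x (c *: u) = c * 'd p x u by rewrite linearZ.
move: A B; rewrite dE dE'.
move: (p (c *: u + (h *: v + x)) : R) (p (c *: u + x) : R) (p x : R).
move: ('d p x u : R) ('d p x v : R) => a b P Q r A B.
have -> : (P - Q) * h - h ^+ 2 * b
    = ((P - (r + (c * a + h * b))) - (Q - (r + c * a))) * h by ring.
have -> : e * h ^+ 2 = (e / 2 * h + e / 2 * h) * h by field.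
rewrite normrM (gtr0_norm h0) ler_pM2r //.
by apply: (le_trans (ler_normB _ _)); apply: lerD.
Unshelve. all: by end_near.
Qed.

(** Both second derivatives, multiplied by h^2, lie within e / 2 * h^2 of the same mixed difference,
    so they differ by at most any e > 0. *)
Lemma derive_sym_real f x u v : (\forall y \near x, differentiable f y) ->
  differentiable ('D_u f) x -> differentiable ('D_v f) x ->
  'D_v ('D_u f) x = 'D_u ('D_v f) x.
Proof.
move=> nf du dv; apply/eqP; rewrite -subr_eq0 -normr_le0; apply/ler_addgt0Pl => e e0.
rewrite addr0.
have e2 : 0 < e / 2 by rewrite divr_gt0.
have A := second_difference v nf du e2; have B := second_difference u nf dv e2.
have [h [[h0 {}A] {}B]] := filter_ex (filterI (filterI (nbhs_right_gt 0) A) B).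
have h20 : 0 < h ^+ 2 by rewrite exprn_gt0.
move: A B; have -> : h *: v + (h *: u + x) = h *: u + (h *: v + x) by rewrite addrCA.
move: ('D_v ('D_u f) x : R) ('D_u ('D_v f) x : R) => b a.
move: (f (h *: u + (h *: v + x)) : R) (f (h *: u + x) : R) (f (h *: v + x) : R) (f x : R).
move=> f1 f2 f3 f4.
move=> A B; rewrite -(ler_pM2l h20) -[X in X * `|_|](gtr0_norm h20) -normrM.
move: A B; rewrite !ler_norml => /andP[A1 A2] /andP[B1 B2].
by apply/andP; split; lra.
Qed.

End Schwarz.

Section Jacobian.
Context {R : realType} {n : nat}.

Lemma derive_ebase (W : normedModType R) (f : 'rV[R]_n -> W) x v :
  differentiable f x -> 'D_v f x = \sum_i v 0 i *: 'D_(ebase i) f x.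
Proof.
move=> df; rewrite deriveE // {1}(row_sum_delta v) linear_sum.
by apply: eq_bigr => i _; rewrite linearZ deriveE.
Qed.

Lemma smooth_ext (W : normedModType R) (U : set 'rV[R]_n) (f g : 'rV[R]_n -> W) :
  open U -> (forall x, U x -> f x = g x) -> smooth_on U g -> smooth_on U f.
Proof.
move=> oU fg sg.
have nr x : U x -> \near x, U x by move=> Ux; exact: open_nbhs_nbhs.
pose P f := exists2 g : 'rV[R]_n -> W, smooth_on U g & forall x, U x -> f x = g x.
apply: (@smooth_ind _ _ _ U P) => //; last by exists g.
- move=> {sg} {}f [{fg} g sg fg] x Ux.
  apply: diff_near_eq (smooth_diff sg Ux); apply: filterS (nr _ Ux) => y; exact: fg.
- move=> {sg} {}f i [{fg} g sg fg]; exists (fun x => 'D_(ebase i) g x).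
    by exists (fun x => 'D_(ebase i) g x) => //; exact: smooth_partial.
  by move=> x Ux; apply: near_eq_derive; apply: filterS (nr _ Ux) => y; exact: fg.
Qed.

Lemma smooth_coord m (U : set 'rV[R]_n) (f : 'rV[R]_n -> 'rV[R]_m) j :
  open U -> smooth_on U f -> smooth_on U (fun x => f x 0 j : R^o).
Proof.
move=> oU sf.
pose P (h : 'rV[R]_n -> R^o) :=
  exists2 f : 'rV[R]_n -> 'rV[R]_m, smooth_on U f & h = (fun x => f x 0 j).
apply: (@smooth_ind _ _ _ U P) => //; last by exists f.
- by move=> _ [g sg ->] x Ux; apply: (differentiable_mxP _ _).1; exact: smooth_diff Ux.
- move=> _ i [g sg ->]; exists (fun x => ('D_(ebase i) g x) 0 j).
    by exists (fun x => 'D_(ebase i) g x) => //; exact: smooth_partial.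
  by move=> x Ux; rewrite derive_mxE //; exact: smooth_diff Ux.
Qed.

Lemma smooth_derive m (U : set 'rV[R]_n) (f : 'rV[R]_n -> 'rV[R]_m) v :
  open U -> smooth_on U f -> smooth_on U (fun x => 'D_v f x).
Proof.
move=> oU sf.
apply: (@smooth_ext _ U _ (fun x => \sum_i v 0 i *: 'D_(ebase i) f x)) => //.
  by move=> x Ux; apply: derive_ebase; exact: smooth_diff Ux.
pose P (h : 'rV[R]_n -> 'rV[R]_m) := exists2 g : 'I_n -> 'rV[R]_n -> 'rV[R]_m,
  (forall i, smooth_on U (g i)) & h = (fun x => \sum_i v 0 i *: g i x).
have dZ g x i : smooth_on U g -> U x ->
    differentiable (fun x => v 0 i *: (g x : 'rV[R]_m)) x.
  by move=> sg Ux; apply: (@differentiableZ _ _ _ g); exact: smooth_diff Ux.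
apply: (@smooth_ind _ _ _ U P) => //; last first.
- by exists (fun i x => 'D_(ebase i) f x) => // i; exact: smooth_partial.
- move=> _ i [g sg ->]; exists (fun x => \sum_j v 0 j *: 'D_(ebase i) (g j) x).
    by exists (fun j x => 'D_(ebase i) (g j) x) => // j; exact: smooth_partial.
  move=> x Ux; rewrite derive_big => [|j]; last exact: dZ.
  by apply: eq_bigr => j _; apply: deriveZ; apply: diff_derivable; exact: smooth_diff Ux.
- by move=> _ [g sg ->] x Ux; apply: differentiable_big => i; exact: dZ.
Qed.

End Jacobian.

Section Composition.
Context {R : realType} {n m p : nat}.
Context (U : set 'rV[R]_n) (V : set 'rV[R]_m) (f : 'rV[R]_n -> 'rV[R]_m).

(* The smooth multiples of maps [g \o f] are stable under partial derivatives *)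
(* up to sums, by the chain rule.                                             *)
Inductive comp_class : ('rV[R]_n -> 'rV[R]_p) -> Prop :=
| comp_class_comp (g : 'rV[R]_m -> 'rV[R]_p) : smooth_on V g -> comp_class (g \o f)
| comp_class_scale (a : 'rV[R]_n -> R^o) h : smooth_on U a -> comp_class h ->
    comp_class (fun x => a x *: h x)
| comp_class_add h1 h2 : comp_class h1 -> comp_class h2 -> comp_class (fun x => h1 x + h2 x).

Lemma smooth_comp (g : 'rV[R]_m -> 'rV[R]_p) : open U -> smooth_on U f -> smooth_on V g ->
  (forall x, U x -> V (f x)) -> smooth_on U (g \o f).
Proof.
move=> oU sf sg UV.
have dc h : comp_class h -> forall x, U x -> differentiable h x.
  elim=> [{}h sh|a {}h sa _ IH|h1 h2 _ IH1 _ IH2] x Ux.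
  - by apply: differentiable_comp; [exact: smooth_diff Ux|exact: smooth_diff (UV _ Ux)].
  - by apply: differentiable_scale; [exact: smooth_diff Ux|exact: IH].
  - by apply: (@differentiableD _ _ _ h1 h2); [exact: IH1|exact: IH2].
apply: (@smooth_ind _ _ _ U comp_class) => //; last exact: comp_class_comp.
move=> h i; elim=> [{}h sh|a {}h sa ch [h' ch' eh]|h1 h2 c1 [h1' ch1 e1] c2 [h2' ch2 e2]].
- pose D r x := \sum_(j <- r) 'D_(ebase i) f x 0 j *: ('D_(ebase j) h \o f) x.
  (* The empty sum of the chain rule must lie in the class; it is the composite of the zero map with
     f. *)
  have c0 : comp_class (fun=> 0).
    have -> : (fun=> 0) = (fun=> 0) \o f :> ('rV[R]_n -> 'rV[R]_p) by [].
    apply: comp_class_comp => s x Vx.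
    have -> : partials s (fun=> 0) = (cst 0 : 'rV[R]_m -> 'rV[R]_p).
      elim: s => //= a s ->; apply/funext => y; exact: derive_cst.
    exact: differentiable_cst.
  have cD r : comp_class (D r).
    elim: r => [|j r IH].
      by have -> : D [::] = (fun=> 0) by apply/funext => x; rewrite /D big_nil.
    have -> : D (j :: r)
      = (fun x => 'D_(ebase i) f x 0 j *: ('D_(ebase j) h \o f) x + D r x).
      by apply/funext => x; rewrite /D big_cons.
    apply: comp_class_add => //; apply: comp_class_scale.
      by apply: smooth_coord => //; exact: smooth_partial.
    by apply: (@comp_class_comp (fun x => 'D_(ebase j) h x)); exact: smooth_partial.
  exists (D (index_enum _)) => // x Ux.
  rewrite derive_chain; [|exact: smooth_diff Ux|exact: smooth_diff (UV _ Ux)].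
  by rewrite (derive_ebase _ (smooth_diff sh (UV _ Ux))).
- exists (fun x => 'D_(ebase i) a x *: h x + a x *: h' x).
    apply: comp_class_add; apply: comp_class_scale => //.
    exact: (@smooth_partial _ _ _ _ _ i sa).
  move=> x Ux; rewrite -(eh _ Ux).
  apply/rowP => j; have da := smooth_diff sa Ux; have dh := dc _ ch _ Ux.
  rewrite -derive_mxE; last exact: differentiable_scale.
  have -> : (fun y => (a y *: h y) 0 j) = (fun y => a y * h y 0 j).
    by apply/funext => y; rewrite mxE.
  have dhj := (differentiable_mxP _ _).1 dh 0 j.
  have va : derivable a x (ebase i) by apply: diff_derivable.
  have vh : derivable (fun y => h y 0 j) x (ebase i) by apply: diff_derivable.
  have -> : 'D_(ebase i) (fun y => a y * h y 0 j) x
     = a x *: 'D_(ebase i) (fun y => h y 0 j) x + h x 0 j *: 'D_(ebase i) a x.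
    exact: (deriveM va vh).
  by rewrite derive_mxE // !mxE addrC; congr (_ + _); exact: mulrC.
- exists (fun x => h1' x + h2' x); first exact: comp_class_add.
  move=> x Ux; rewrite -(e1 _ Ux) -(e2 _ Ux).
  by apply: (@deriveD _ _ _ h1 h2); apply: diff_derivable; exact: dc Ux.
Qed.

End Composition.

(** * Levi-Civita connection in coordinates *)

Section BilinearForms.
Context {R : realType} {n : nat}.
Implicit Types (G H : 'M[R]_n) (u v w : 'rV[R]_n).

Lemma bilDl G u v w : bil G (u + v) w = bil G u w + bil G v w.
Proof. by rewrite /bil !mulmxDl mxE. Qed.
Lemma bilDr G u v w : bil G w (u + v) = bil G w u + bil G w v.
Proof. by rewrite /bil linearD mulmxDr mxE. Qed.
Lemma bilZl G a u w : bil G (a *: u) w = a * bil G u w.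
Proof. by rewrite /bil -!scalemxAl mxE. Qed.
Lemma bilZr G a u w : bil G w (a *: u) = a * bil G w u.
Proof. by rewrite /bil linearZ -scalemxAr mxE. Qed.
Lemma bilBl G u v w : bil G (u - v) w = bil G u w - bil G v w.
Proof. by rewrite bilDl -scaleN1r bilZl mulN1r. Qed.
Lemma bil0l G w : bil G 0 w = 0.
Proof. by rewrite /bil !mul0mx mxE. Qed.
Lemma bil_formD G H u v : bil (G + H) u v = bil G u v + bil H u v.
Proof. by rewrite /bil mulmxDr mulmxDl mxE. Qed.
Lemma bil_formZ G a u v : bil (a *: G) u v = a * bil G u v.
Proof. by rewrite /bil -scalemxAr -scalemxAl mxE. Qed.

Lemma bil_sumr G w (I : Type) (r : seq I) (f : I -> 'rV[R]_n) :
  bil G w (\sum_(i <- r) f i) = \sum_(i <- r) bil G w (f i).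
Proof.
elim: r => [|i r IH]; last by rewrite !big_cons bilDr IH.
by rewrite !big_nil /bil trmx0 mulmx0 mxE.
Qed.

Lemma bil_ebase G u w : bil G u w = \sum_j w 0 j * bil G u (ebase j).
Proof.
by rewrite {1}(row_sum_delta w) bil_sumr; apply: eq_bigr => j _; rewrite bilZr.
Qed.

Lemma bil_pos_unit G : (forall u, u != 0 -> 0 < bil G u u) -> G \in unitmx.
Proof.
move=> pos; rewrite unitmxE unitfE; apply/det0P => -[u u0 uG].
by have := pos u u0; rewrite /bil uG mul0mx mxE ltxx.
Qed.

Lemma bil_inj G u v : (forall w, w != 0 -> 0 < bil G w w) ->
  (forall w, bil G u w = bil G v w) -> u = v.
Proof.
move=> pos E; apply/eqP; rewrite -subr_eq0; apply: contraTT isT => /pos.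
by rewrite bilBl E subrr ltxx.
Qed.

Lemma evD (a : 'cV[R]_n) u v : ev a (u + v) = ev a u + ev a v.
Proof. by rewrite /ev mulmxDl mxE. Qed.
Lemma evZ (a : 'cV[R]_n) t u : ev a (t *: u) = t * ev a u.
Proof. by rewrite /ev -scalemxAl mxE. Qed.
Lemma evN (a : 'cV[R]_n) u : ev a (- u) = - ev a u.
Proof. by rewrite -scaleN1r evZ mulN1r. Qed.
Lemma mulmx_ev (a : 'cV[R]_n) u : u *m a = (ev a u)%:M.
Proof. by rewrite [LHS]mx11_scalar. Qed.

End BilinearForms.

Lemma differentiable_bil (R : realType) (V : normedModType R) n (A : V -> 'M[R]_n)
    (b c : V -> 'rV[R]_n) x :
  differentiable A x -> differentiable b x -> differentiable c x ->
  differentiable (fun y => bil (A y) (b y) (c y)) x.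
Proof.
move=> dA db dc; apply: (differentiable_mxP _ _).1.
by apply: differentiable_mulmx; [exact: differentiable_mulmx|exact: differentiable_tr].
Qed.

Lemma derive_tr (R : realType) (V : normedModType R) m n (f : V -> 'M[R]_(m, n)) x v :
  differentiable f x -> 'D_v (fun y => (f y)^T) x = ('D_v f x)^T.
Proof.
move=> df; apply/matrixP => i j; rewrite mxE -(derive_mxE _ _ _ df).
rewrite -(derive_mxE _ _ _ (differentiable_tr df)); congr ('D_v _ x).
by apply/funext => y; rewrite mxE.
Qed.

Lemma derive_bil (R : realType) (V : normedModType R) n (A : V -> 'M[R]_n)
    (b c : V -> 'rV[R]_n) x v :
  differentiable A x -> differentiable b x -> differentiable c x ->
  'D_v (fun y => bil (A y) (b y) (c y)) x =
  bil ('D_v A x) (b x) (c x) + bil (A x) ('D_v b x) (c x) + bil (A x) (b x) ('D_v c x).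
Proof.
move=> dA db dc; have dbA := differentiable_mulmx db dA; have dcT := differentiable_tr dc.
have dbAc := differentiable_mulmx dbA dcT.
apply: etrans (derive_mxE _ _ _ dbAc) _.
rewrite (derive_mulmx v dbA dcT) (derive_mulmx v db dA) (derive_tr v dc).
move: ('D_v A x) ('D_v b x) ('D_v c x) => A' b' c'.
by rewrite /bil mulmxDl [LHS]mxE [X in X + _]mxE; congr (_ + _); rewrite addrC.
Qed.

Section Jacobian.
Context {R : realType} {m n : nat}.
Implicit Types (F : 'rV[R]_m -> 'rV[R]_n) (x u v : 'rV[R]_m).

(* The library's [jacobian], in a form that is visibly differentiable for smooth [F]. *)
Definition jac F x : 'M[R]_(m, n) := \sum_i (ebase i)^T *m 'D_(ebase i) F x.

Lemma mulmx_ebase_tr p (v : 'rV[R]_m) i (w : 'rV[R]_p) :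
  v *m ((ebase i)^T *m w) = v 0 i *: w.
Proof.
rewrite mulmxA; have -> : v *m (ebase i)^T = (v 0 i)%:M.
  apply/rowP => j; rewrite !ord1 !mxE (bigD1 i) //= big1 => [|k /negbTE ne].
    by rewrite !mxE !eqxx mulr1 addr0 mulr1n.
  by rewrite !mxE ne andbF mulr0.
by rewrite mul_scalar_mx.
Qed.

Lemma mul_jac F x v : differentiable F x -> v *m jac F x = 'D_v F x.
Proof.
move=> dF; rewrite mulmx_sumr (derive_ebase _ dF).
by apply: eq_bigr => i _; rewrite mulmx_ebase_tr.
Qed.

Lemma differentiable_jac U F x : smooth_on U F -> U x -> differentiable (jac F) x.
Proof.
move=> sF Ux; apply: differentiable_big => i.
apply: differentiable_mulmxl.
exact: smooth_diff (smooth_partial i sF) _ Ux.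
Qed.

(** Both sides are second derivatives of F in the directions u and v, so this is Schwarz's theorem
    applied to each coordinate. *)
Lemma derive_jac_sym U F x u v : open U -> smooth_on U F -> U x ->
  v *m 'D_u (jac F) x = u *m 'D_v (jac F) x.
Proof.
move=> oU sF Ux; have nU : \near x, U x by exact: open_nbhs_nbhs.
have dj := differentiable_jac sF Ux.
have E a b : a *m 'D_b (jac F) x = 'D_b (fun y => 'D_a F y) x.
  have -> : 'D_b (fun y => 'D_a F y) x = 'D_b (fun y => a *m jac F y) x.
    apply: near_eq_derive; apply: filterS nU => y Uy; rewrite mul_jac //.
    exact: smooth_diff sF _ Uy.
  by rewrite derive_mulmxl.
have dD a y : U y -> differentiable (fun z => 'D_a F z) y.
  by move=> Uy; exact: smooth_diff (smooth_derive a oU sF) _ Uy.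
have dF y : U y -> differentiable F y by exact: smooth_diff.
rewrite (E u v) (E v u); apply/rowP => j.
have Em a b : ('D_b (fun y => 'D_a F y) x) 0 j = 'D_b (fun y => ('D_a F y) 0 j) x.
  by rewrite derive_mxE //; exact: dD.
apply: etrans (Em v u) _; apply: etrans _ (esym (Em u v)).
have Ej a b : 'D_b (fun y => ('D_a F y) 0 j) x = 'D_b ('D_a (fun y => F y 0 j)) x.
  by apply: near_eq_derive; apply: filterS nU => y Uy; rewrite derive_mxE //; exact: dF.
apply: etrans (Ej v u) _; apply: etrans _ (esym (Ej u v)); apply: derive_sym_real.
- by apply: filterS nU => y Uy; exact: (differentiable_mxP _ _).1 (dF _ Uy) _ _.
- apply: diff_near_eq ((differentiable_mxP _ _).1 (dD v _ Ux) 0 j).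
  by apply: filterS nU => y Uy; rewrite derive_mxE //; exact: dF.
- apply: diff_near_eq ((differentiable_mxP _ _).1 (dD u _ Ux) 0 j).
  by apply: filterS nU => y Uy; rewrite derive_mxE //; exact: dF.
Qed.

End Jacobian.

Section Connection.
Context {R : realType} {n : nat}.
Implicit Types (G : 'rV[R]_n -> 'M[R]_n) (X Y xi : 'rV[R]_n -> 'rV[R]_n).
Implicit Types (x u v w : 'rV[R]_n).

(** Koszul's formula, known on basis vectors from the definition, extends to every w because each of
    its terms is linear in w. *)
Lemma christoffel1_pairing G x u v w : differentiable G x ->
  (christoffel1 G x u v *m w^T) 0 0 = 2^-1 * (bil ('D_u G x) v w + bil ('D_v G x) u w
      - bil ('D_w G x) u v).
Proof.
move=> dG; rewrite (derive_ebase w dG) /christoffel1.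
have gen (A B : 'M[R]_n) (C : 'I_n -> 'M[R]_n) :
    ((\row_j (2^-1 * (bil A v (ebase j) + bil B u (ebase j) - bil (C j) u v))) *m w^T) 0 0
    = 2^-1 * (bil A v w + bil B u w - bil (\sum_j w 0 j *: C j) u v).
  have -> : bil (\sum_j w 0 j *: C j) u v = \sum_j w 0 j * bil (C j) u v.
    elim/big_rec2: _ => [|j a D _ IH]; first by rewrite /bil mulmx0 mul0mx mxE.
    by rewrite bil_formD bil_formZ IH.
  rewrite (bil_ebase A v w) (bil_ebase B u w) -big_split -sumrB mulr_sumr mxE.
  by apply: eq_bigr => j _; rewrite !mxE /=; ring.
exact: gen.
Qed.

Lemma christoffel1_linear G x u v a w : differentiable G x ->
  christoffel1 G x (a *: u + w) v = a *: christoffel1 G x u v + christoffel1 G x w v.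
Proof.
move=> dG; apply/rowP => j; rewrite !mxE deriveDl // deriveZl //.
move: ('D_u G x) ('D_w G x) ('D_v G x) ('D_(ebase j) G x) => A B C D.
by rewrite bil_formD bil_formZ !bilDl !bilZl; ring.
Qed.

Lemma christoffel1_linearr G x u v a w : differentiable G x ->
  christoffel1 G x v (a *: u + w) = a *: christoffel1 G x v u + christoffel1 G x v w.
Proof.
move=> dG; apply/rowP => j; rewrite !mxE deriveDl // deriveZl //.
move: ('D_u G x) ('D_w G x) ('D_v G x) ('D_(ebase j) G x) => A B C D.
by rewrite bil_formD bil_formZ !bilDl !bilDr !bilZl !bilZr; ring.
Qed.

Lemma christoffel2_linear G x u v a w : differentiable G x ->
  christoffel2 G x (a *: u + w) v = a *: christoffel2 G x u v + christoffel2 G x w v.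
Proof.
by move=> dG; rewrite /christoffel2 christoffel1_linear // mulmxDl scalemxAl.
Qed.

Lemma christoffel2_linearr G x u v a w : differentiable G x ->
  christoffel2 G x v (a *: u + w) = a *: christoffel2 G x v u + christoffel2 G x v w.
Proof.
by move=> dG; rewrite /christoffel2 christoffel1_linearr // mulmxDl scalemxAl.
Qed.

Lemma christoffel2Z G x u v a : differentiable G x ->
  christoffel2 G x u (a *: v) = a *: christoffel2 G x u v.
Proof.
move=> dG; have H b w := christoffel2_linearr v u b w dG.
have := H a 0; have := H 1 (0 : 'rV[R]_n); rewrite !addr0 !scale1r => E.
have -> : christoffel2 G x u 0 = 0.
  by have := H (-1) v; rewrite !scaleN1r !addNr.
by rewrite addr0.
Qed.

Lemma christoffel2_pairing G x u v w : differentiable G x -> G x \in unitmx ->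
  bil (G x) (christoffel2 G x u v) w = 2^-1 * (bil ('D_u G x) v w + bil ('D_v G x) u w
      - bil ('D_w G x) u v).
Proof.
move=> dG uG; rewrite -christoffel1_pairing // /bil /christoffel2.
by rewrite mulmxKV.
Qed.

(** The endomorphism v |-> nabla_v xi as a matrix acting on the right. Having it as a matrix
    function of x lets second covariant derivatives be computed with the product rule. *)
Definition conn G xi x : 'M[R]_n :=
  \sum_i (ebase i)^T *m ('D_(ebase i) xi x + christoffel2 G x (ebase i) (xi x)).

Lemma mul_conn G xi x v : differentiable G x -> differentiable xi x ->
  v *m conn G xi x = 'D_v xi x + christoffel2 G x v (xi x).
Proof.
move=> dG dx; have -> : christoffel2 G x v (xi x)
    = \sum_i v 0 i *: christoffel2 G x (ebase i) (xi x).
  rewrite {1}(row_sum_delta v); elim/big_rec2: _ => [|i a A _ <-].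
    by have := christoffel2_linear 0 (xi x) (-1) 0 dG; rewrite !scaleN1r !addNr.
  exact: christoffel2_linear.
rewrite mulmx_sumr (derive_ebase _ dx) -big_split /=.
by apply: eq_bigr => i _; rewrite mulmx_ebase_tr scalerDr.
Qed.

Lemma differentiable_conn U G xi x : open U -> smooth_on U G -> smooth_on U xi ->
  (forall y, U y -> G y \in unitmx) -> U x -> differentiable (conn G xi) x.
Proof.
move=> oU sG sx uG Ux; have nU : \near x, U x by exact: open_nbhs_nbhs.
have dx := smooth_diff sx Ux; have dG := smooth_diff sG Ux.
have dGi i := smooth_diff (smooth_partial i sG) Ux.
apply: differentiable_big => i.
apply: differentiable_mulmxl.
apply: (@differentiableD _ _ _ (fun x => 'D_(ebase i) xi x)
  (fun x => christoffel2 G x (ebase i) (xi x))).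
  exact: smooth_diff (smooth_partial i sx) _ Ux.
apply: differentiable_mulmx; last by apply: differentiable_invmx => //; exact: filterS nU.
apply/differentiable_mxP => a j.
(* In the middle Koszul term the direction of differentiation [xi y] varies with y; expanding it
   over the basis leaves products of differentiable functions. *)
apply: (@diff_near_eq _ _ _ _ (fun y => 2^-1 * (bil ('D_(ebase i) G y) (xi y) (ebase j)
   + \sum_l xi y 0 l * bil ('D_(ebase l) G y) (ebase i) (ebase j)
   - bil ('D_(ebase j) G y) (ebase i) (xi y)))).
  apply: filterS nU => y Uy; rewrite mxE; congr (_ * (_ + _ - _)).
  rewrite (derive_ebase _ (smooth_diff sG Uy)); elim/big_rec2: _ => [|l c A _ <-].
    by rewrite /bil mulmx0 mul0mx mxE.
  by rewrite bil_formD bil_formZ.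
apply: differentiableM; first exact: differentiable_cst.
apply: (@differentiableB _ _ _ (fun y => _ + _)); last first.
  by apply: differentiable_bil => //; exact: differentiable_cst.
apply: (@differentiableD _ _ _ (fun y => bil _ _ _)).
  by apply: differentiable_bil => //; exact: differentiable_cst.
apply: differentiable_big => l; apply: differentiableM; first exact: (differentiable_mxP _ _).1.
by apply: differentiable_bil => //; exact: differentiable_cst.
Qed.

(* The value of [R(X, Y) xi] at [x] when [X x = u] and [Y x = v]. *)
Definition curv G xi x u v : 'rV[R]_n :=
  v *m 'D_u (conn G xi) x - u *m 'D_v (conn G xi) x
  + christoffel2 G x u (v *m conn G xi x) - christoffel2 G x v (u *m conn G xi x).

(** Tensoriality of the curvature in X and Y: the derivatives of X and Y produced by the product
    rule cancel against nabla_[X, Y] xi. *)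
Lemma curvature_curv U W G xi X Y x : open U -> smooth_on U G -> smooth_on U xi ->
  (forall y, U y -> G y \in unitmx) -> open W -> smooth_on W X -> smooth_on W Y ->
  U x -> W x -> curvature G X Y xi x = curv G xi x (X x) (Y x).
Proof.
move=> oU sG sx uG oW sX sY Ux Wx.
have nU : \near x, U x by exact: open_nbhs_nbhs.
have dc := differentiable_conn oU sG sx uG Ux.
have nab Z y : U y -> nabla G Z xi y = Z y *m conn G xi y.
  by move=> Uy; rewrite mul_conn //; [exact: smooth_diff sG _ Uy|exact: smooth_diff sx _ Uy].
have nn Z1 Z2 : differentiable Z2 x -> nabla G Z1 (nabla G Z2 xi) x
   = 'D_(Z1 x) Z2 x *m conn G xi x + Z2 x *m 'D_(Z1 x) (conn G xi) x
     + christoffel2 G x (Z1 x) (Z2 x *m conn G xi x).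
  move=> dZ; have -> : nabla G Z1 (nabla G Z2 xi) x = 'D_(Z1 x) (nabla G Z2 xi) x
      + christoffel2 G x (Z1 x) (nabla G Z2 xi x) by [].
  rewrite (nab Z2 x Ux); congr (_ + _).
  apply: etrans _ (derive_mulmx (Z1 x) dZ dc).
  by apply: near_eq_derive; apply: filterS nU => y Uy; rewrite nab.
rewrite /curvature nab // !nn; [|exact: smooth_diff sX _ Wx|exact: smooth_diff sY _ Wx].
rewrite /bracket mulmxBl /curv.
have alg (a b p q c d : 'rV[R]_n) : (a + p + c) - (b + q + d) - (a - b) = p - q + c - d.
  by apply/rowP => j; rewrite !mxE; ring.
exact: alg.
Qed.

End Connection.

(* [p, p'], [q, q'] and [r, r'] are the second derivatives of an immersion in the   *)
(* three pairs of directions; Koszul's combination leaves only one of them.         *)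
Lemma koszul_alg (R : realType) n (H A B C : 'M[R]_n) (a b c p p' q q' r r' : 'rV[R]_n) :
  (forall u v, bil H u v = bil H v u) -> p' = p -> q' = q -> r' = r ->
  2^-1 * ((bil A b c + bil H p c + bil H b q) + (bil B a c + bil H p' c + bil H a r)
    - (bil C a b + bil H q' b + bil H a r'))
  = 2^-1 * (bil A b c + bil B a c - bil C a b) + bil H p c.
Proof. by move=> sy -> -> ->; rewrite (sy b); field. Qed.

(** * Connection and curvature of a metric that is a sum of pulled back metrics *)

Section Family.
Context {R : realType} {m n : nat} {I : finType}.
Variables (O : set 'rV[R]_m) (V : I -> set 'rV[R]_n) (F : I -> 'rV[R]_m -> 'rV[R]_n).
Variables (G : 'rV[R]_m -> 'M[R]_m) (xi : 'rV[R]_m -> 'rV[R]_m).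
Variables (Gc : I -> 'rV[R]_n -> 'M[R]_n) (xic : I -> 'rV[R]_n -> 'rV[R]_n) (s : R).
Hypotheses (oO : open O) (sF : forall i, smooth_on O (F i)).
Hypotheses (sG : smooth_on O G) (sxi : smooth_on O xi).
Hypothesis (posG : forall x u, O x -> u != 0 -> 0 < bil (G x) u u).
Hypotheses (oV : forall i, open (V i)) (FV : forall i x, O x -> V i (F i x)).
Hypotheses (sGc : forall i, smooth_on (V i) (Gc i)) (sxic : forall i, smooth_on (V i) (xic i)).
Hypothesis (uGc : forall i y, V i y -> Gc i y \in unitmx).
Hypothesis (symGc : forall i y u v, V i y -> bil (Gc i y) u v = bil (Gc i y) v u).
Hypothesis (isoF : forall x u v, O x ->
  bil (G x) u v = \sum_i bil (Gc i (F i x)) (u *m jac (F i) x) (v *m jac (F i) x)).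
Hypothesis (relxi : forall i x, O x -> xi x *m jac (F i) x = s *: xic i (F i x)).
Hypothesis (tan : forall x (v : 'rV[R]_m), O x ->
  exists z : 'rV[R]_m, forall i,
    z *m jac (F i) x = s *: (v *m jac (F i) x *m conn (Gc i) (xic i) (F i x))).

Local Notation J i x := (jac (F i) x).
Local Notation Bc i := (conn (Gc i) (xic i)).

Implicit Types (x u v w : 'rV[R]_m).

Let nO x : O x -> \near x, O x.
Proof. by move=> Ox; exact: open_nbhs_nbhs. Qed.
Let dF i x : O x -> differentiable (F i) x.
Proof. exact: smooth_diff (sF i) x. Qed.
Let dJ i x : O x -> differentiable (jac (F i)) x.
Proof. exact: differentiable_jac (sF i). Qed.
Let dGc i x : O x -> differentiable (Gc i) (F i x).
Proof. by move=> Ox; exact: (smooth_diff (@sGc i) (FV i Ox)). Qed.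
Let uG x : O x -> G x \in unitmx.
Proof. by move=> Ox; apply: bil_pos_unit => u; exact: posG. Qed.
Let derive_F i x v : O x -> 'D_v (F i) x = v *m J i x.
Proof. by move=> Ox; rewrite mul_jac //; exact: dF. Qed.

Let derive_comp_F p q (h : 'rV[R]_n -> 'M[R]_(p, q)) i x v :
  O x -> differentiable h (F i x) ->
  'D_v (fun y => h (F i y)) x = 'D_(v *m J i x) h (F i x).
Proof.
move=> Ox dh; apply: etrans (derive_chain v (dF i Ox) dh) _.
by congr ('D_ _ h _); exact: derive_F.
Qed.

Let derive_uJ i x u v : O x -> 'D_v (fun y => u *m J i y) x = u *m 'D_v (jac (F i)) x.
Proof. by move=> Ox; apply: derive_mulmxl; exact: dJ. Qed.

Let derive_metric x u v w : O x ->
  bil ('D_w G x) u v = \sum_i (bil ('D_(w *m J i x) (Gc i) (F i x)) (u *m J i x) (v *m J i x)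
     + bil (Gc i (F i x)) (u *m 'D_w (jac (F i)) x) (v *m J i x)
     + bil (Gc i (F i x)) (u *m J i x) (v *m 'D_w (jac (F i)) x)).
Proof.
move=> Ox; have dG := smooth_diff sG Ox.
have dGF i : differentiable (fun y => Gc i (F i y)) x.
  exact: differentiable_comp (dF i Ox) (dGc i Ox).
have duJ i (a : 'rV[R]_m) : differentiable (fun y => a *m J i y) x.
  by apply: differentiable_mulmxl; exact: dJ.
have dterm i : differentiable (fun y => bil (Gc i (F i y)) (u *m J i y) (v *m J i y)) x.
  exact: differentiable_bil.
have := @derive_bil R _ _ G (cst u) (cst v) x w dG
  (differentiable_cst _ _) (differentiable_cst _ _).
have z (H : 'M[R]_m) a : bil H 0 a = 0 /\ bil H a 0 = 0.
  by rewrite /bil !mul0mx trmx0 mulmx0 mxE.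
rewrite !derive_cst (z _ _).1 (z _ _).2 !addr0 => <-.
have -> : 'D_w (fun y => bil (G y) (cst u y) (cst v y)) x =
   'D_w (fun y => \sum_i bil (Gc i (F i y)) (u *m J i y) (v *m J i y)) x.
  by apply: near_eq_derive; apply: filterS (nO Ox) => y Oy; exact: isoF.
apply: etrans (derive_big _ _ _ dterm) _; apply: eq_bigr => i _.
apply: etrans (derive_bil w (dGF i) (duJ i u) (duJ i v)) _.
by rewrite (derive_comp_F _ Ox (dGc i Ox)) (derive_uJ _ _ _ Ox) (derive_uJ _ _ _ Ox).
Qed.

(** Gauss formula: the connection of G is the tangential part of that of the product.
    Differentiating [isoF] brings in second derivatives of the maps; in Koszul's combination their
    symmetry leaves only one of them ([koszul_alg]). *)
Lemma christoffel2_pullback x u v w : O x ->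
  bil (G x) (christoffel2 G x u v) w = \sum_i bil (Gc i (F i x))
    (christoffel2 (Gc i) (F i x) (u *m J i x) (v *m J i x) + v *m 'D_u (jac (F i)) x)
    (w *m J i x).
Proof.
move=> Ox; apply: etrans (christoffel2_pairing u v w (smooth_diff sG Ox) (uG Ox)) _.
have E3 (a a' b b' c c' : R) : a = a' -> b = b' -> c = c' ->
  2^-1 * (a + b - c) = 2^-1 * (a' + b' - c') by move=> -> -> ->.
apply: etrans (E3 _ _ _ _ _ _ (derive_metric v w u Ox) (derive_metric u w v Ox)
  (derive_metric u v w Ox)) _.
rewrite -big_split -sumrB mulr_sumr; apply: eq_bigr => i _ /=.
apply: etrans _ (esym (bilDl _ _ _ _)).
apply: etrans _ (esym (congr1 (+%R ^~ _)
  (christoffel2_pairing _ _ _ (dGc i Ox) (uGc (FV i Ox))))).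
apply: koszul_alg; [|exact: (derive_jac_sym _ _ oO (sF i) Ox)..].
by move=> a b; exact: symGc (FV i Ox).
Qed.

Let dconnc i x : O x -> differentiable (Bc i) (F i x).
Proof.
by move=> Ox; exact: (differentiable_conn (@oV i) (@sGc i) (@sxic i) (@uGc i) (FV i Ox)).
Qed.

(** A priori nabla xi is only the tangential part of the ambient vector with components s nabla
    xi_i. By [tan] that vector is tangent, so projecting loses nothing and equality holds in each
    component. *)
Lemma conn_pullback i x : O x -> conn G xi x *m J i x = s *: (J i x *m Bc i (F i x)).
Proof.
move=> Ox; apply/row_matrixP => a; rewrite !rowE.
move: (delta_mx 0 a) => v; rewrite mulmxA -scalemxAr mulmxA.
(* z is the tangent vector with the required components; it is identified with nabla_v xi by pairing
   both with an arbitrary w. *)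
have [z zE] := tan v Ox; rewrite -zE; congr (_ *m _).
apply: (bil_inj (fun w => @posG x w Ox)) => w; rewrite (isoF z w Ox).
have dG := smooth_diff sG Ox; have dxi := smooth_diff sxi Ox.
rewrite (mul_conn v dG dxi) bilDl.
apply: etrans (congr2 +%R (isoF _ _ Ox) (christoffel2_pullback _ _ _ Ox)) _.
rewrite -big_split; apply: eq_bigr => {a}j _ /=; rewrite -bilDl; congr (bil _ _ _).
rewrite zE (relxi j Ox) (christoffel2Z _ _ _ (dGc j Ox)).
have dxc := smooth_diff (@sxic j) (FV j Ox).
have dxF : differentiable (fun y => xic j (F j y)) x.
  exact: differentiable_comp (dF j Ox) dxc.
have E : 'D_v xi x *m J j x + xi x *m 'D_v (jac (F j)) x
    = s *: 'D_(v *m J j x) (xic j) (F j x).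
  apply: etrans (esym (derive_mulmx v dxi (dJ j Ox))) _.
  apply: etrans (_ : 'D_v (fun y => s *: xic j (F j y)) x = _).
    by apply: near_eq_derive; apply: filterS (nO Ox) => y Oy; exact: relxi.
  apply: etrans (deriveZ s (_ : derivable (fun y => xic j (F j y)) x v)) _.
    by apply: diff_derivable.
  by apply: (congr1 (GRing.scale s)); exact: (derive_comp_F v Ox dxc).
rewrite (mul_conn _ (dGc j Ox) dxc) scalerDr -E.
have alg (a b c : 'rV[R]_n) : a + (c + b) = a + b + c by rewrite addrCA addrC.
exact: alg.
Qed.

(** Comes from differentiating [conn_pullback] along u. The leading term, with a second derivative
    of F_i, is symmetric in u and v, so it will disappear from the curvature. *)
Let half_curv x u v w : O x ->
  bil (G x) (v *m 'D_u (conn G xi) x + christoffel2 G x u (v *m conn G xi x)) w =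
  \sum_i bil (Gc i (F i x)) (s *: (v *m 'D_u (jac (F i)) x *m Bc i (F i x)
     + (v *m J i x *m 'D_(u *m J i x) (Bc i) (F i x)
     + christoffel2 (Gc i) (F i x) (u *m J i x) (v *m J i x *m Bc i (F i x))))) (w *m J i x).
Proof.
move=> Ox; rewrite bilDl.
apply: etrans (congr2 +%R (isoF _ _ Ox) (christoffel2_pullback _ _ _ Ox)) _.
rewrite -big_split; apply: eq_bigr => j _ /=; rewrite -bilDl; congr (bil _ _ _).
have dB := differentiable_conn oO sG sxi uG Ox.
have dBF : differentiable (fun y => Bc j (F j y)) x.
  exact: differentiable_comp (dF j Ox) (dconnc j Ox).
have dJB := differentiable_mulmx (dJ j Ox) dBF.
have E : 'D_u (conn G xi) x *m J j x + conn G xi x *m 'D_u (jac (F j)) x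
   = s *: ('D_u (jac (F j)) x *m Bc j (F j x) + J j x *m 'D_(u *m J j x) (Bc j) (F j x)).
  apply: etrans (esym (derive_mulmx u dB (dJ j Ox))) _.
  apply: etrans (_ : 'D_u (fun y => s *: (J j y *m Bc j (F j y))) x = _).
    by apply: near_eq_derive; apply: filterS (nO Ox) => y Oy; exact: conn_pullback.
  apply: etrans (deriveZ s (_ : derivable (fun y => J j y *m Bc j (F j y)) x u)) _.
    by apply: diff_derivable.
  apply: (congr1 (GRing.scale s)); apply: etrans (derive_mulmx u (dJ j Ox) dBF) _.
  apply: (congr1 (+%R _)); apply: (congr1 (mulmx _)).
  exact: (derive_comp_F u Ox (dconnc j Ox)).
have vE := congr1 (mulmx v) E.
have vBJ : v *m conn G xi x *m J j x = s *: (v *m J j x *m Bc j (F j x)).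
  by rewrite -mulmxA (conn_pullback j Ox) -scalemxAr mulmxA.
rewrite vBJ (christoffel2Z _ _ _ (dGc j Ox)).
move: vE; rewrite !mulmxDr -scalemxAr mulmxDr !mulmxA !scalerDr => vE.
have alg (a b c d e : 'rV[R]_n) : a + b = d + e -> a + (c + b) = d + (e + c).
  by move=> ab; rewrite addrCA ab addrCA [c + e]addrC.
exact: alg.
Qed.

(** No second fundamental form enters: [conn_pullback] is an equality of ambient vectors, so it may
    be differentiated first and projected afterwards. *)
Lemma curv_pullback x u v w : O x ->
  bil (G x) (curv G xi x u v) w =
  \sum_i bil (Gc i (F i x)) (s *: curv (Gc i) (xic i) (F i x) (u *m J i x) (v *m J i x))
    (w *m J i x).
Proof.
move=> Ox; rewrite /curv.
have alg N (a b c d : 'rV[R]_N) : a - b + c - d = (a + c) - (b + d).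
  by apply/rowP => j; rewrite !mxE; ring.
rewrite alg bilBl.
apply: etrans (congr2 (fun a b => a - b) (half_curv u v w Ox) (half_curv v u w Ox)) _.
rewrite -sumrB; apply: eq_bigr => i _; rewrite -bilBl; congr (bil _ _ _).
rewrite -scalerBr; congr (_ *: _); rewrite alg.
rewrite (derive_jac_sym u v oO (sF i) Ox).
by rewrite opprD addrACA subrr add0r.
Qed.

End Family.

(** * Lie derivatives and almost contact structures *)

(** As affinors act on the right, the products stand in the opposite order to the usual D_xi A - (D
    xi) A + A (D xi). *)
Lemma lie_affinorE (R : realType) n (xi : 'rV[R]_n -> 'rV[R]_n)
    (A : 'rV[R]_n -> 'M[R]_n) x :
  differentiable A x -> differentiable xi x ->
  lie_affinor xi A x = 'D_(xi x) A x - A x *m jac xi x + jac xi x *m A x.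
Proof.
move=> dA dxi; apply/row_matrixP => i; rewrite rowK /bracket.
have -> : (fun y => row i (A y)) = (fun y => ebase i *m A y).
  by apply/funext => y; rewrite rowE.
rewrite (derive_mulmxl _ _ dA) derive_cst sub0r mulNmx opprK.
rewrite -(mul_jac _ dxi) -(mul_jac _ dxi).
by rewrite [RHS]rowE mulmxDr mulmxBr !mulmxA rowE.
Qed.

Section LiePullback.
Context {R : realType} {m n : nat}.
Variables (O : set 'rV[R]_m) (V : set 'rV[R]_n) (F : 'rV[R]_m -> 'rV[R]_n) (s : R).
Variables (A : 'rV[R]_m -> 'M[R]_m) (xi : 'rV[R]_m -> 'rV[R]_m).
Variables (Ac : 'rV[R]_n -> 'M[R]_n) (xic : 'rV[R]_n -> 'rV[R]_n).
Hypotheses (oO : open O) (sF : smooth_on O F) (FV : forall x, O x -> V (F x)).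
Hypotheses (sA : smooth_on O A) (sxi : smooth_on O xi).
Hypotheses (sAc : smooth_on V Ac) (sxic : smooth_on V xic).
Hypothesis (relA : forall x, O x -> A x *m jac F x = jac F x *m Ac (F x)).
Hypothesis (relxi : forall x, O x -> xi x *m jac F x = s *: xic (F x)).

(** Naturality of the Lie derivative under related fields. Differentiating the two relations
    produces second derivatives of F, which cancel in the combination defining L_xi A. *)
Lemma lie_affinor_pullback x : O x ->
  lie_affinor xi A x *m jac F x = s *: (jac F x *m lie_affinor xic Ac (F x)).
Proof.
move=> Ox; have nO : \near x, O x by exact: open_nbhs_nbhs.
have dF := smooth_diff sF Ox; have dJ := differentiable_jac sF Ox.
have dA := smooth_diff sA Ox; have dxi := smooth_diff sxi Ox.
have dAc := smooth_diff sAc (FV Ox); have dxc := smooth_diff sxic (FV Ox).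
have dAF : differentiable (fun y => Ac (F y)) x by exact: differentiable_comp dF dAc.
have dxF : differentiable (fun y => xic (F y)) x by exact: differentiable_comp dF dxc.
rewrite (lie_affinorE dA dxi) (lie_affinorE dAc dxc).
have E1 : 'D_(xi x) A x *m jac F x + A x *m 'D_(xi x) (jac F) x
  = 'D_(xi x) (jac F) x *m Ac (F x) + jac F x *m (s *: 'D_(xic (F x)) Ac (F x)).
  apply: etrans (esym (derive_mulmx (xi x) dA dJ)) _.
  apply: etrans (_ : 'D_(xi x) (fun y => jac F y *m Ac (F y)) x = _).
    by apply: near_eq_derive; apply: filterS nO => y Oy; exact: relA.
  apply: etrans (derive_mulmx (xi x) dJ dAF) _.
  apply: (congr1 (+%R _)); apply: (congr1 (mulmx _)).
  apply: etrans (derive_chain (xi x) dF dAc) _.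
  have -> : 'D_(xi x) F x = s *: xic (F x) by rewrite -relxi // mul_jac.
  exact: deriveZl.
(* Here [relxi] is differentiated in every direction v; symmetry of second derivatives exchanges v
   and xi. *)
have E2 : jac xi x *m jac F x + 'D_(xi x) (jac F) x = s *: (jac F x *m jac xic (F x)).
  apply/row_matrixP => i; rewrite !rowE.
  move: (delta_mx 0 i) => v; rewrite mulmxDr mulmxA (mul_jac v dxi) -scalemxAr mulmxA.
  rewrite (derive_jac_sym _ _ oO sF Ox).
  apply: etrans (esym (derive_mulmx v dxi dJ)) _.
  apply: etrans (_ : 'D_v (fun y => s *: xic (F y)) x = _).
    by apply: near_eq_derive; apply: filterS nO => y Oy; exact: relxi.
  apply: etrans (deriveZ s (_ : derivable (fun y => xic (F y)) x v)) _.
    by apply: diff_derivable.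
  apply: (congr1 (GRing.scale s)); apply: etrans (derive_chain v dF dxc) _.
  by rewrite -(mul_jac v dF) (mul_jac _ dxc).
move: E1 E2.
move: ('D_(xi x) A x) ('D_(xic (F x)) Ac (F x)) ('D_(xi x) (jac F) x) => DA DAc DJ.
move=> /(canRL (addrK _)) E1 /(canRL (addrK _)) E2.
rewrite mulmxDl mulmxBl E1 -[A x *m _ *m _]mulmxA E2 -[jac xi x *m _ *m _]mulmxA relA //.
rewrite [jac xi x *m _]mulmxA E2 mulmxBr mulmxBl -!scalemxAr -!scalemxAl !mulmxA relA //.
rewrite mulmxDr mulmxBr !scalerDr scalerN !mulmxA.
have alg (a b c d e f : 'M[R]_(m, n)) : a + b - c - (d - c) + (e - a) = b - d + e.
  by apply/matrixP => i j; rewrite !mxE; ring.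
exact: alg.
Qed.

End LiePullback.

Section LocalAlmostContact.
Context {R : realType} {n : nat} (V : set 'rV[R]_n).
Variables (phi : 'rV[R]_n -> 'M[R]_n) (xi : 'rV[R]_n -> 'rV[R]_n).
Variables (eta : 'rV[R]_n -> 'cV[R]_n) (G : 'rV[R]_n -> 'M[R]_n).
Hypotheses (oV : open V) (sphi : smooth_on V phi) (sxi : smooth_on V xi).
Hypotheses (seta : smooth_on V eta) (sG : smooth_on V G).
Hypothesis (phi2 : forall x v, V x -> v *m phi x *m phi x = - v + ev (eta x) v *: xi x).
Hypothesis (etaxi : forall x, V x -> ev (eta x) (xi x) = 1).
Hypothesis (Gphi : forall x u v, V x ->
  bil (G x) (u *m phi x) (v *m phi x) = bil (G x) u v - ev (eta x) u * ev (eta x) v).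
Hypothesis (Gsym : forall x u v, V x -> bil (G x) u v = bil (G x) v u).
Hypothesis (Gpos : forall x u, V x -> u != 0 -> 0 < bil (G x) u u).

(** For w = phi xi, phi w = phi^2 xi = 0, so the formula for phi^2 w gives w = eta(w) xi. Applying
    phi yields eta(w) w = phi w = 0, hence w = 0. *)
Lemma xi_phi x : V x -> xi x *m phi x = 0.
Proof.
move=> Vx; set w := xi x *m phi x.
have w1 : w *m phi x = 0 by rewrite /w phi2 // etaxi // scale1r addNr.
have w2 : w = ev (eta x) w *: xi x.
  by have := phi2 w Vx; rewrite w1 mul0mx => /esym/eqP; rewrite addrC subr_eq0 => /eqP.
have : ev (eta x) w *: w = 0 by rewrite {2}/w scalemxAl -w2.
by move/eqP; rewrite scaler_eq0 => /orP[/eqP e|/eqP //]; rewrite w2 e scale0r.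
Qed.

(** Evaluating phi^3 v as phi(phi^2 v) and as phi^2(phi v) leaves eta(phi v) xi = 0. *)
Lemma eta_phi x v : V x -> ev (eta x) (v *m phi x) = 0.
Proof.
move=> Vx; have := phi2 (v *m phi x) Vx.
rewrite (phi2 v Vx) mulmxDl mulNmx -scalemxAl (xi_phi Vx) scaler0.
move=> /addrI /(congr1 (ev (eta x))); rewrite evZ (etaxi Vx) mulr1 => <-.
by rewrite /ev mul0mx mxE.
Qed.

Lemma eta_metric x u : V x -> ev (eta x) u = bil (G x) u (xi x).
Proof.
move=> Vx; have := Gphi u (xi x) Vx; rewrite xi_phi // etaxi // mulr1.
by rewrite Gsym // bil0l => /esym/eqP; rewrite subr_eq0 => /eqP.
Qed.

(** Metric compatibility: 2 g(nabla_v xi, xi) is the derivative of g(xi, xi) = 1. This is what makes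
    nabla xi liftable to the sewed manifold. *)
Lemma eta_nabla_xi x v : V x -> ev (eta x) (v *m conn G xi x) = 0.
Proof.
move=> Vx; have nV : \near x, V x by exact: open_nbhs_nbhs.
have dG := smooth_diff sG Vx; have dxi := smooth_diff sxi Vx.
have uG : G x \in unitmx by apply: bil_pos_unit => u; exact: Gpos.
rewrite eta_metric // (mul_conn _ dG dxi) bilDl (christoffel2_pairing _ _ _ dG uG).
have := derive_bil v dG dxi dxi.
have -> : 'D_v (fun y => bil (G y) (xi y) (xi y)) x = 0.
  rewrite -(derive_cst (1 : R^o) x v); apply: near_eq_derive; apply: filterS nV => y Vy.
  by rewrite -eta_metric // etaxi.
rewrite [bil _ (xi x) ('D_v xi x)]Gsym // addrK.
move: (bil ('D_v G x) (xi x) (xi x)) (bil (G x) ('D_v xi x) (xi x)) => a b E.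
by lra.
Qed.

Lemma phi_lie_xi x : V x -> xi x *m lie_affinor xi phi x = 0.
Proof.
move=> Vx; have nV : \near x, V x by exact: open_nbhs_nbhs.
have dp := smooth_diff sphi Vx; have dxi := smooth_diff sxi Vx.
rewrite (lie_affinorE dp dxi) mulmxDr mulmxBr !mulmxA xi_phi // mul0mx subr0.
rewrite (mul_jac _ dxi) addrC.
apply: etrans (esym (derive_mulmx (xi x) dxi dp)) _.
rewrite -(derive_cst (0 : 'rV[R]_n) x (xi x)); apply: near_eq_derive.
apply: filterS nV => y Vy.
exact: xi_phi.
Qed.

Hypothesis closed : forall x u v, V x -> ext_d eta x u v = 0.

(* Since [eta] is closed, L_xi eta = 0, hence L_xi (phi^2) = 0. *)
Lemma lie_phi_anticomm x : V x ->
  phi x *m lie_affinor xi phi x + lie_affinor xi phi x *m phi x = 0.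
Proof.
move=> Vx; have nV : \near x, V x by exact: open_nbhs_nbhs.
have dp := smooth_diff sphi Vx; have dxi := smooth_diff sxi Vx.
have de := smooth_diff seta Vx.
have pp y : V y -> phi y *m phi y = - 1%:M + eta y *m xi y.
  move=> Vy; apply/row_matrixP => i; rewrite !rowE mulmxDr mulmxN mulmx1 !mulmxA phi2 //.
  by rewrite mulmx_ev mul_scalar_mx.
rewrite (lie_affinorE dp dxi).
have E1 : 'D_(xi x) phi x *m phi x + phi x *m 'D_(xi x) phi x
    = 'D_(xi x) eta x *m xi x + eta x *m 'D_(xi x) xi x.
  apply: etrans (esym (derive_mulmx (xi x) dp dp)) _.
  apply: etrans (_ : 'D_(xi x) (fun y => cst (- 1%:M) y + eta y *m xi y) x = _).
    by apply: near_eq_derive; apply: filterS nV => y Vy; exact: pp.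
  apply: etrans (deriveD _ _) _.
  - exact: derivable_cst.
  - by apply: diff_derivable; exact: differentiable_mulmx.
  - by rewrite derive_cst add0r; exact: derive_mulmx.
(* This is L_xi eta = 0, as in Cartan's formula: d eta = 0 and eta(xi) is constant. *)
have E2 : 'D_(xi x) eta x + jac xi x *m eta x = 0.
  apply/row_matrixP => i; rewrite !rowE; move: (delta_mx 0 i) => v.
  rewrite mulmx0 mulmxDr mulmxA (mul_jac _ dxi).
  have -> : v *m 'D_(xi x) eta x = xi x *m 'D_v eta x.
    by rewrite !mulmx_ev; apply/(congr1 scalar_mx)/subr0_eq; exact: closed.
  have := derive_mulmx v dxi de.
  have -> : 'D_v (fun y => xi y *m eta y) x = 0.
    rewrite -(derive_cst (1%:M : 'M[R]_1) x v); apply: near_eq_derive.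
    apply: filterS nV => y Vy.
    by rewrite mulmx_ev etaxi.
  by rewrite addrC => <-.
move: E1; rewrite -(mul_jac (xi x) dxi); move: E2 (pp x Vx).
move: ('D_(xi x) eta x) ('D_(xi x) phi x) (jac xi x) => De Dp J E2 P E1.
have -> : phi x *m (Dp - phi x *m J + J *m phi x)
   + (Dp - phi x *m J + J *m phi x) *m phi x
   = Dp *m phi x + phi x *m Dp - phi x *m phi x *m J + J *m (phi x *m phi x).
  rewrite !mulmxDl !mulmxDr !mulNmx !mulmxN !mulmxA.
  by apply/matrixP => a b; rewrite !mxE; ring.
rewrite E1 P mulmxDl mulNmx mul1mx mulmxDr mulmxN mulmx1 -[eta x *m xi x *m J]mulmxA.
have -> : J *m (eta x *m xi x) = - (De *m xi x).
  by rewrite mulmxA -mulNmx; congr (_ *m _); apply/eqP; rewrite -addr_eq0 addrC E2.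
by apply/matrixP => a b; rewrite !mxE; ring.
Qed.

End LocalAlmostContact.

(** * Pointwise nullity conditions on manifolds *)

Section Charts.
Context {R : realType} {n : nat} (M : manifold R n).

Definition chart_img (c : chart M) : set 'rV[R]_n := chart_map M c @` chart_dom M c.

Lemma open_img c : open (chart_img c).
Proof. exact: chart_img_open. Qed.

Lemma chart_imgP c p : chart_dom M c p -> chart_img c (chart_map M c p).
Proof. by exists p. Qed.

Lemma open_chart_img (c : chart M) (A : set M) :
  open A -> open (chart_map M c @` (chart_dom M c `&` A)).
Proof.
move=> oA; rewrite openE => _ [p [dp Ap] <-].
have n1 : nbhs (chart_map M c p) (chart_map M c @` chart_dom M c).
  by apply: open_nbhs_nbhs; split; [exact: chart_img_open | exists p].
have n2 : nbhs (chart_map M c p) (chart_inv M c @^-1` A).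
  by apply: (chart_inv_cont dp); rewrite chart_mapK //; exact: open_nbhs_nbhs.
apply: filterS (filterI n1 n2) => x [[q dq <-]] /=; rewrite chart_mapK // => Aq.
by exists q.
Qed.

Lemma differentiable_transition c c' p : chart_dom M c p -> chart_dom M c' p ->
  differentiable (transition c c') (chart_map M c p).
Proof. by move=> dp dp'; apply: (smooth_diff (@transition_smooth _ _ M c c')); exists p. Qed.

(** Extends the coordinate vector v of chart c to a field on the whole chart domain; its components
    in another chart are obtained by pushing v forward under the transition map. *)
Definition const_field (c : chart M) (v : 'rV[R]_n) : chart M -> 'rV[R]_n -> 'rV[R]_n :=
  fun c' => (fun x => 'D_v (transition c c') x) \o transition c' c.

Lemma const_fieldE c v x : chart_img c x -> const_field c v c x = v.
Proof.
move=> [p dp <-]; rewrite /const_field /= /transition /= chart_mapK //.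
rewrite -[RHS](derive_id (chart_map M c p) v); apply: near_eq_derive.
have : nbhs (chart_map M c p) (chart_img c).
  by apply: open_nbhs_nbhs; split; [exact: chart_img_open|exact: chart_imgP].
by apply: filterS => _ [q dq <-] /=; rewrite chart_mapK.
Qed.

Lemma const_field_vector_field c v : vector_field (chart_dom M c) (const_field c v).
Proof.
split=> [c'|c1 c2 p Wp d1 d2 /=].
  apply: (@smooth_comp _ _ _ _ _ (chart_map M c @` (chart_dom M c `&` chart_dom M c'))).
  - exact: open_overlap.
  - exact: transition_smooth.
  - by apply: smooth_derive; [exact: open_overlap|exact: transition_smooth].
  - move=> _ [p [dp dp'] <-]; exists p => //.
    by apply: (congr1 (chart_map M c)); rewrite chart_mapK.
rewrite /const_field /=.
have tE a b : chart_dom M a p -> transition a b (chart_map M a p) = chart_map M b p.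
  by move=> da; rewrite /transition /= chart_mapK.
rewrite (tE c2) // (tE c1) //.
have d12 := differentiable_transition d1 d2; have dc1 := differentiable_transition Wp d1.
have d12' : differentiable (transition c1 c2) (transition c c1 (chart_map M c p)).
  by rewrite tE.
have E := derive_chain v dc1 d12'; rewrite (tE c c1 Wp) in E.
apply: etrans _ (deriveE _ d12); apply: etrans _ E; apply: near_eq_derive.
have : nbhs (chart_map M c p) (chart_map M c @` (chart_dom M c `&` chart_dom M c1)).
  by apply: open_nbhs_nbhs; split; [exact: open_overlap|exists p].
by apply: filterS => _ [q [dq dq1] <-] /=; rewrite /transition /= !chart_mapK.
Qed.

Context (S : acm_structure M).
Implicit Types (c : chart M) (x u v : 'rV[R]_n).

Lemma smooth_phi c : smooth_on (chart_img c) (phi S c).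
Proof. exact: (phi_field S).1. Qed.
Lemma smooth_xi c : smooth_on (chart_img c) (xi S c).
Proof. by have := (xi_field S).1 c; rewrite setIT; apply. Qed.
Lemma smooth_eta c : smooth_on (chart_img c) (eta S c).
Proof. exact: (eta_field S).1. Qed.
Lemma smooth_metr c : smooth_on (chart_img c) (metr S c).
Proof. by have [+ _ _ _] := metr_field S; apply. Qed.

Lemma metr_sym c x u v : chart_img c x -> bil (metr S c x) u v = bil (metr S c x) v u.
Proof. by have [_ _ H _] := metr_field S; move=> [p dp <-]; exact: H. Qed.
Lemma metr_pos c x u : chart_img c x -> u != 0 -> 0 < bil (metr S c x) u u.
Proof. by have [_ _ _ H] := metr_field S; move=> [p dp <-]; exact: H. Qed.
Lemma metr_unit c x : chart_img c x -> metr S c x \in unitmx.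
Proof. by move=> cx; apply: bil_pos_unit => u; exact: metr_pos. Qed.
Lemma phi_sqr_img c x v : chart_img c x ->
  v *m phi S c x *m phi S c x = - v + ev (eta S c x) v *: xi S c x.
Proof. by move=> [p dp <-]; exact: phi_sqr. Qed.
Lemma eta_xi_img c x : chart_img c x -> ev (eta S c x) (xi S c x) = 1.
Proof. by move=> [p dp <-]; exact: eta_xi. Qed.
Lemma metr_phi_img c x u v : chart_img c x ->
  bil (metr S c x) (u *m phi S c x) (v *m phi S c x)
  = bil (metr S c x) u v - ev (eta S c x) u * ev (eta S c x) v.
Proof. by move=> [p dp <-]; exact: metr_phi. Qed.

Lemma chart_eta_phi c x v : chart_img c x -> ev (eta S c x) (v *m phi S c x) = 0.
Proof. exact: eta_phi (@phi_sqr_img c) (@eta_xi_img c) x v. Qed.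

Lemma chart_eta_nabla_xi c x v : chart_img c x ->
  ev (eta S c x) (v *m conn (metr S c) (xi S c) x) = 0.
Proof.
move=> cx; apply: (eta_nabla_xi (V := chart_img c) (phi := phi S c)) => //.
- exact: open_img.
- exact: smooth_xi.
- exact: smooth_metr.
- exact: phi_sqr_img.
- exact: eta_xi_img.
- exact: metr_phi_img.
- exact: metr_sym.
- exact: metr_pos.
Qed.

Lemma xi_htens c x : chart_img c x -> xi S c x *m htens S c x = 0.
Proof.
move=> cx; rewrite /htens -scalemxAr.
by rewrite (phi_lie_xi (@open_img c) (@smooth_phi c) (@smooth_xi c) (@phi_sqr_img c)
  (@eta_xi_img c) cx) scaler0.
Qed.

Lemma htens_phi_anticomm c x : closed_form (eta S) -> chart_img c x ->
  phi S c x *m htens S c x + htens S c x *m phi S c x = 0.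
Proof.
move=> cl cx; rewrite /htens -scalemxAr -scalemxAl -scalerDr.
have cl' y u v : chart_img c y -> ext_d (eta S c) y u v = 0 by move=> [p dp <-]; exact: cl.
by rewrite (lie_phi_anticomm (@open_img c) (@smooth_phi c) (@smooth_xi c) (@smooth_eta c)
  (@phi_sqr_img c) (@eta_xi_img c) cl' cx) scaler0.
Qed.

Definition nullity_rhs c x (k m m' : R) u v : 'rV[R]_n :=
  let h := htens S c x in let h' := htens' S c x in
  let etaX := ev (eta S c x) u in let etaY := ev (eta S c x) v in
  k *: (etaY *: u - etaX *: v) + m *: (etaY *: (u *m h) - etaX *: (v *m h))
  + m' *: (etaY *: (u *m h') - etaX *: (v *m h')).

Definition nullity_at c x k m m' : Prop :=
  forall u v, curv (metr S c) (xi S c) x u v = nullity_rhs c x k m m' u v.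

(** Both sides depend only on the values of X and Y at the point, by [curvature_curv], and any two
    vectors are values of constant fields on a chart domain. *)
Lemma nullity_pointwise (kappa mu mu' : M -> R) : nullity S kappa mu mu' <->
  forall c p, chart_dom M c p -> nullity_at c (chart_map M c p) (kappa p) (mu p) (mu' p).
Proof.
have cE (W : set M) X Y c p : open W -> vector_field W X -> vector_field W Y ->
    W p -> chart_dom M c p -> let x := chart_map M c p in
    curvature (metr S c) (X c) (Y c) (xi S c) x = curv (metr S c) (xi S c) x (X c x) (Y c x).
  move=> oW vX vY Wp dp x.
  apply: (@curvature_curv _ _ (chart_img c) (chart_map M c @` (chart_dom M c `&` W))) => //.
  - exact: open_img.
  - exact: smooth_metr.
  - exact: smooth_xi.
  - exact: metr_unit.
  - exact: open_chart_img.
  - exact: vX.1.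
  - exact: vY.1.
  - exact: chart_imgP.
  - by exists p.
split=> [H c p dp u v|H W X Y oW vX vY c p Wp dp].
  have := H _ _ _ (chart_dom_open c) (const_field_vector_field c u)
    (const_field_vector_field c v) c p dp dp.
  rewrite /= (cE (chart_dom M c)) //;
    [|exact: chart_dom_open|exact: const_field_vector_field..].
  by rewrite !const_fieldE //; exact: chart_imgP.
by rewrite /= (cE W) //; exact: H.
Qed.

End Charts.

Lemma open_chart_img_preim (R : realType) (m n : nat) (M : manifold R m) (N : manifold R n)
    (W : set M) (F : M -> N) c d : open W -> (forall p, W p -> {for p, continuous F}) ->
  open (chart_map M c @` (chart_dom M c `&` W `&` F @^-1` chart_dom N d)).
Proof.
move=> oW cF; rewrite -setIA; apply: open_chart_img; rewrite openE => p [Wp dFp].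
apply: filterI; first exact: open_nbhs_nbhs.
by apply: (cF p Wp); apply: open_nbhs_nbhs; split; [exact: chart_dom_open|].
Qed.

(* Used with a single map and [s = 1] for isomorphisms, and with the components of  *)
(* the inclusion and [s = 1 / sqrt k] for sewed cells.                              *)
Section StructureMaps.
Context {R : realType} {m n : nat} {I : finType} {M : manifold R m} {N : I -> manifold R n}.
Variables (S : acm_structure M) (T : forall i, acm_structure (N i)).
Variables (c : chart M) (d : forall i, chart (N i)) (O : set 'rV[R]_m).
Variables (F : I -> 'rV[R]_m -> 'rV[R]_n) (s : R).
Hypotheses (oO : open O) (Oc : O `<=` chart_img c).
Hypothesis sF : forall i, smooth_on O (F i).
Hypothesis FV : forall i x, O x -> chart_img (d i) (F i x).
Hypothesis rel_phi : forall i x, O x ->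
  phi S c x *m jac (F i) x = jac (F i) x *m phi (T i) (d i) (F i x).
Hypothesis rel_xi : forall i x, O x -> xi S c x *m jac (F i) x = s *: xi (T i) (d i) (F i x).
Hypothesis rel_eta : forall i x v, O x ->
  ev (eta (T i) (d i) (F i x)) (v *m jac (F i) x) = s * ev (eta S c x) v.
Hypothesis rel_metr : forall x u v, O x -> bil (metr S c x) u v =
  \sum_i bil (metr (T i) (d i) (F i x)) (u *m jac (F i) x) (v *m jac (F i) x).
Hypothesis horizontal_lift : forall x (w : I -> 'rV[R]_n), O x ->
  (forall i, ev (eta (T i) (d i) (F i x)) (w i) = 0) ->
  exists z : 'rV[R]_m, forall i, z *m jac (F i) x = w i.

(** The pulled back metrics add up to a positive definite one, so a tangent vector killed by all the
    differentials vanishes. *)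
Lemma jac_joint_inj x (u v : 'rV[R]_m) : O x ->
  (forall i, u *m jac (F i) x = v *m jac (F i) x) -> u = v.
Proof.
move=> Ox E; apply: (bil_inj (fun w => @metr_pos _ _ _ S c x w (Oc Ox))) => w.
by rewrite !rel_metr //; apply: eq_bigr => i _; rewrite E.
Qed.

Let smooth_onW (W : normedModType R) (f : 'rV[R]_m -> W) :
  smooth_on (chart_img c) f -> smooth_on O f.
Proof. by move=> sf t x Ox; exact: sf t x (Oc Ox). Qed.

Lemma htens_pullback i x : O x ->
  htens S c x *m jac (F i) x = s *: (jac (F i) x *m htens (T i) (d i) (F i x)).
Proof.
move=> Ox; rewrite /htens -scalemxAl -scalemxAr.
have -> : lie_affinor (xi S c) (phi S c) x *m jac (F i) x
    = s *: (jac (F i) x *m lie_affinor (xi (T i) (d i)) (phi (T i) (d i)) (F i x)).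
  apply: (lie_affinor_pullback (V := chart_img (d i)) oO (sF i)) => //.
  - exact: FV.
  - exact: smooth_onW (@smooth_phi _ _ _ S c).
  - exact: smooth_onW (@smooth_xi _ _ _ S c).
  - exact: smooth_phi.
  - exact: smooth_xi.
  - exact: rel_phi.
  - exact: rel_xi.
by rewrite !scalerA mulrC.
Qed.

(** By joint injectivity it is enough to check each component, where closedness of the target form
    gives the identity. *)
Lemma htens_anticomm_pullback x : (forall i, closed_form (eta (T i))) -> O x ->
  phi S c x *m htens S c x + htens S c x *m phi S c x = 0.
Proof.
move=> cl Ox; apply/row_matrixP => a; rewrite !rowE mulmx0; move: (delta_mx 0 a) => v.
apply: (jac_joint_inj Ox) => i; rewrite mul0mx -mulmxA mulmxDl.
rewrite -[phi S c x *m _ *m _]mulmxA htens_pullback // -scalemxAr mulmxA rel_phi //.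
rewrite -[htens S c x *m _ *m _]mulmxA rel_phi // mulmxA htens_pullback //.
rewrite -scalemxAl -scalerDr -!mulmxA -mulmxDr htens_phi_anticomm; [|exact: cl|exact: FV].
by rewrite mulmx0 scaler0 mulmx0.
Qed.

(** Vectors are compared through their inner products with every w. In each target one factor s
    comes from xi and one from eta, whence s^2 k; in the other two terms one of these factors is
    absorbed by h, which is related to s h_i, whence s mu and s mu'. *)
Lemma nullity_at_pullback x k mu mu' : O x ->
  (forall i, nullity_at (T i) (d i) (F i x) k mu mu') ->
  nullity_at S c x (s ^+ 2 * k) (s * mu) (s * mu').
Proof.
move=> Ox nul u v.
apply: (bil_inj (fun w => @metr_pos _ _ _ S c x w (Oc Ox))) => w.
have -> : bil (metr S c x) (curv (metr S c) (xi S c) x u v) w = \sum_i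
    bil (metr (T i) (d i) (F i x)) (s *: curv (metr (T i) (d i)) (xi (T i) (d i)) (F i x)
      (u *m jac (F i) x) (v *m jac (F i) x)) (w *m jac (F i) x).
  apply: (curv_pullback (O := O) (V := fun i => chart_img (d i)) oO sF) => //.
  - exact: smooth_onW (@smooth_metr _ _ _ S c).
  - exact: smooth_onW (@smooth_xi _ _ _ S c).
  - by move=> y a Oy; apply: metr_pos; exact: Oc.
  - by move=> i; exact: open_img.
  - by move=> i; exact: smooth_metr.
  - by move=> i; exact: smooth_xi.
  - by move=> i y; exact: metr_unit.
  - by move=> i y a b; exact: metr_sym.
  - move=> y a Oy; apply: horizontal_lift => // i.
    by rewrite evZ chart_eta_nabla_xi ?mulr0 //; exact: FV.
rewrite rel_metr //; apply: eq_bigr => i _; congr (bil _ _ _).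
rewrite nul /nullity_rhs !rel_eta // /htens'.
have hJ (a : 'rV[R]_m) : a *m htens S c x *m jac (F i) x
   = s *: (a *m jac (F i) x *m htens (T i) (d i) (F i x)).
  by rewrite -mulmxA htens_pullback // -scalemxAr mulmxA.
have pJ (a : 'rV[R]_m) : a *m (phi S c x *m htens S c x) *m jac (F i) x
   = s *: (a *m jac (F i) x *m (phi (T i) (d i) (F i x) *m htens (T i) (d i) (F i x))).
  by rewrite mulmxA hJ -[a *m _ *m jac _ _]mulmxA rel_phi // !mulmxA.
rewrite !mulmxDl -!scalemxAl !mulmxDl !mulNmx -!scalemxAl !hJ !pJ.
by apply/rowP => j; rewrite !mxE; ring.
Qed.

End StructureMaps.

(** Subtracting the two conditions at Y = xi gives a u + b h u + d h phi u = 0 on Ker eta. Comparing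
    it with its conjugates under phi isolates a, and then the pair (b, d) acts on h u like a complex
    number of squared modulus b^2 + d^2. *)
Lemma nullity_at_unique (R : realType) n (M : manifold R n) (S : acm_structure M) c x
    (k mu mu' k2 mu2 mu2' : R) : (1 < n)%N -> chart_img c x ->
  phi S c x *m htens S c x + htens S c x *m phi S c x = 0 ->
  nullity_at S c x k mu mu' -> nullity_at S c x k2 mu2 mu2' ->
  k2 = k /\ (htens S c x != 0 -> mu2 = mu /\ mu2' = mu').
Proof.
move=> n1 cx anti N1 N2.
set h := htens S c x in anti *; set p := phi S c x in anti *.
set e := eta S c x; set X := xi S c x.
have hp (u : 'rV[R]_n) : u *m h *m p = - (u *m p *m h).
  by apply/eqP; rewrite -addr_eq0 -!mulmxA -mulmxDr addrC anti mulmx0.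
have pp (u : 'rV[R]_n) : ev e u = 0 -> u *m p *m p = - u.
  by move=> u0; rewrite phi_sqr_img // -/e u0 scale0r addr0.
pose a := k2 - k; pose b := mu2 - mu; pose d := mu2' - mu'.
have P (u : 'rV[R]_n) : ev e u = 0 -> a *: u + b *: (u *m h) + d *: (u *m p *m h) = 0.
  move=> u0; have := N2 u X; rewrite N1 /nullity_rhs -/e u0 !scale0r !subr0.
  rewrite eta_xi_img // !scale1r /htens' mulmxA -/h -/p => /eqP.
  rewrite eq_sym -subr_eq0 => /eqP E.
  by rewrite -[RHS]E /a /b /d; apply/rowP => j; rewrite !mxE; ring.
have P' (u : 'rV[R]_n) : ev e u = 0 -> a *: (u *m p) + b *: (u *m p *m h) - d *: (u *m h) = 0.
  move=> u0; have := P (u *m p); rewrite chart_eta_phi // (pp _ u0) mulNmx scalerN; exact.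
have a0 : a = 0.
  have [u uker u0] : exists2 u : 'rV[R]_n, (u <= kermx e)%MS & u != 0.
    apply/rowV0Pn; rewrite kermx_eq0 -row_leq_rank -ltnNge.
    exact: leq_ltn_trans (rank_leq_col _) n1.
  have {uker} eu : ev e u = 0 by move/sub_kermxP: uker; rewrite /ev => ->; rewrite mxE.
  (* Applying phi after the relation and substituting phi u into it give opposite signs in the b-
     and d-terms, by anticommutation; the sum is 2 a phi u = 0. *)
  have E1 := congr1 (mulmx^~ p) (P u eu); have E2 := P' u eu.
  rewrite /= mul0mx !mulmxDl -!scalemxAl hp hp (pp _ eu) mulNmx opprK scalerN in E1.
  have : (2 * a) *: (u *m p) = 0.
    have : a *: (u *m p) - b *: (u *m p *m h) + d *: (u *m h)
       + (a *: (u *m p) + b *: (u *m p *m h) - d *: (u *m h)) = 0 by rewrite E1 E2 addr0.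
    by move=> <-; apply/rowP => j; rewrite !mxE; ring.
  move/eqP; rewrite scaler_eq0 mulf_eq0 pnatr_eq0 /= => /orP[/eqP //|/eqP up].
  by have := pp _ eu; rewrite up mul0mx => /esym/eqP; rewrite oppr_eq0 (negbTE u0).
split=> [|hn0]; first by apply/eqP; rewrite -subr_eq0 -/a a0.
have [i hi] : exists i, row i h != 0.
  apply/existsP; apply: contraNT hn0; rewrite negb_exists => /forallP H.
  by apply/eqP/row_matrixP => i; rewrite row0; have := H i; rewrite negbK => /eqP.
(* Projecting a basis vector to Ker eta leaves its image under h unchanged, because h xi = 0. *)
pose u : 'rV[R]_n := delta_mx 0 i - ev e (delta_mx 0 i) *: X.
have eu : ev e u = 0 by rewrite /u evD evN evZ eta_xi_img // mulr1 subrr.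
have uh : u *m h != 0.
  by rewrite mulmxBl -scalemxAl xi_htens // scaler0 subr0 -rowE.
have := P u eu; have := P' u eu; rewrite a0 !scale0r !add0r => E2 E1.
have : (b ^+ 2 + d ^+ 2) *: (u *m h) = 0.
  have : b *: (b *: (u *m h) + d *: (u *m p *m h))
     - d *: (b *: (u *m p *m h) - d *: (u *m h)) = 0.
    by rewrite E1 E2 !scaler0 subr0.
  by move=> <-; apply/rowP => j; rewrite !mxE; ring.
move/eqP; rewrite scaler_eq0 (negbTE uh) orbF paddr_eq0 ?sqr_ge0 // !sqrf_eq0 !subr_eq0.
by move=> /andP[/eqP -> /eqP ->].
Qed.

(** * Local representatives of maps and transport along local isomorphisms *)

Section Tangent.
Context {R : realType} {m n : nat} {M : manifold R m} {N : manifold R n}.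
Variables (W : set M) (F : M -> N) (c : chart M) (d : chart N).
Hypothesis sF : smooth_map W F.

Definition rep_dom : set 'rV[R]_m :=
  chart_map M c @` (chart_dom M c `&` W `&` F @^-1` chart_dom N d).

Lemma rep_dom_open : open W -> open rep_dom.
Proof. by move=> oW; apply: open_chart_img_preim => //; exact: sF.1. Qed.

Lemma tangent_jac p v : chart_dom M c p -> W p -> chart_dom N d (F p) ->
  tangent F c d p v = v *m jac (local_rep F c d) (chart_map M c p).
Proof.
move=> dp Wp dFp.
have dF : differentiable (local_rep F c d) (chart_map M c p).
  by apply: (smooth_diff (@sF.2 c d)); exists p.
by rewrite /tangent mul_jac // deriveE.
Qed.

Lemma local_rep_chart p : chart_dom M c p ->
  local_rep F c d (chart_map M c p) = chart_map N d (F p).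
Proof. by move=> dp; rewrite /local_rep /= chart_mapK. Qed.

End Tangent.

(** The transport principle for a one-element family with s = 1. The isomorphism may be chosen to
    send p to q, so no relation between the two points is required. *)
Lemma nullity_at_iso (R : realType) n (M N : manifold R n) (S : acm_structure M)
    (T : acm_structure N) c d p q k mu mu' :
  locally_isomorphic S T -> chart_dom M c p -> chart_dom N d q ->
  nullity_at T d (chart_map N d q) k mu mu' -> nullity_at S c (chart_map M c p) k mu mu'.
Proof.
move=> iso dp dq nul.
have [U1 [U2 [th [th' [[oU1 _ U1p _ thp] _ _ [sth _] pres]]]]] := iso p q.
pose L := local_rep th c d; pose O := rep_dom U1 th c d.
have rel x : O x -> exists r, [/\ U1 r, chart_dom M c r, chart_dom N d (th r),
    chart_map M c r = x & L x = chart_map N d (th r)].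
  by move=> [r [[dr Ur] dthr] <-]; exists r; split=> //; exact: local_rep_chart.
have presO x : O x -> [/\ phi S c x *m jac L x = jac L x *m phi T d (L x),
    xi S c x *m jac L x = xi T d (L x),
    forall v, ev (eta T d (L x)) (v *m jac L x) = ev (eta S c x) v &
    forall u v, bil (metr S c x) u v = bil (metr T d (L x)) (u *m jac L x) (v *m jac L x)].
  move=> /rel[r [Ur dr dthr <- ->]].
  have [H1 H2 H3 H4] := pres c d r Ur dr dthr.
  have tE v : tangent th c d r v = v *m jac L (chart_map M c r).
    by exact: (tangent_jac sth v dr Ur dthr).
  split.
  - by apply/row_matrixP => a; rewrite !rowE !mulmxA -!tE H1.
  - by rewrite -tE H2.
  - by move=> v; rewrite H3 tE.
  - by move=> u v; rewrite H4 !tE.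
have Ox : O (chart_map M c p) by exists p => //; split=> //=; rewrite thp.
have Oc : O `<=` chart_img c by move=> x /rel[r [_ dr _ <- _]]; exists r.
(* An isometric differential is injective, hence invertible between equal dimensions; this supplies
   all the lifts that the principle asks for. *)
have uJ x : O x -> jac L x \in unitmx.
  move=> xO; rewrite unitmxE unitfE; apply/det0P => -[v v0 vJ].
  have := @metr_pos _ _ _ S c x v (Oc _ xO) v0; have [_ _ _ ->] := presO x xO.
  by rewrite vJ bil0l ltxx.
have := @nullity_at_pullback R n n 'I_1 M (fun=> N) S (fun=> T) c (fun=> d) O (fun=> L) 1.
move=> /(_ _ Oc _ _ _ _ _ _ _ (chart_map M c p) k mu mu' Ox).
rewrite expr1n !mul1r; apply.
- exact: (rep_dom_open sth).
- by move=> i; exact: sth.2.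
- by move=> i x /rel[r [_ _ dr _ ->]]; exists (th r).
- by move=> i x xO; case: (presO x xO).
- by move=> i x xO; rewrite scale1r; case: (presO x xO).
- by move=> i x v xO; rewrite mul1r; case: (presO x xO).
- by move=> x u v xO; rewrite big_ord1; case: (presO x xO).
- move=> x w xO _; exists (w ord0 *m invmx (jac L x)) => i.
  by rewrite (ord1 i) mulmxKV //; exact: uJ.
- move=> i; have Lp : L (chart_map M c p) = chart_map N d q.
    by rewrite -thp; exact: (local_rep_chart th d dp).
  by rewrite Lp.
Qed.

(** * Sewed cells *)

Section MulRight.
Context {R : realType} {m n p : nat} (A : 'M[R]_(n, p)).
Implicit Types (f : 'rV[R]_m -> 'rV[R]_n).

Lemma derive_mulmxr f x v : differentiable f x -> 'D_v (fun y => f y *m A) x = 'D_v f x *m A.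
Proof.
move=> df; apply: etrans (derive_mulmx v df (differentiable_cst A x)) _.
by rewrite derive_cst mulmx0 addr0.
Qed.

Lemma differentiable_mulmxr f x : differentiable f x -> differentiable (fun y => f y *m A) x.
Proof. move=> df; exact: (differentiable_mulmx df (differentiable_cst A x)). Qed.

Lemma smooth_mulmxr U f : open U -> smooth_on U f -> smooth_on U (fun x => f x *m A).
Proof.
move=> oU sf.
pose P (h : 'rV[R]_m -> 'rV[R]_p) :=
  exists2 f : 'rV[R]_m -> 'rV[R]_n, smooth_on U f & h = (fun x => f x *m A).
apply: (@smooth_ind _ _ _ U P) => //; last by exists f.
- by move=> _ [g sg ->] x Ux; apply: differentiable_mulmxr; exact: smooth_diff Ux.
- move=> _ i [g sg ->]; exists (fun x => 'D_(ebase i) g x *m A).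
    by exists (fun x => 'D_(ebase i) g x) => //; exact: smooth_partial.
  by move=> x Ux; apply: derive_mulmxr; exact: smooth_diff Ux.
Qed.

Lemma jac_mulmxr f x : differentiable f x -> jac (fun y => f y *m A) x = jac f x *m A.
Proof.
move=> df; rewrite mulmx_suml; apply: eq_bigr => i _.
by rewrite -mulmxA; apply: (congr1 (mulmx _)); exact: derive_mulmxr.
Qed.

End MulRight.

Section SewedCells.
Context {R : realType} {k : nat} (hk : (1 < k)%N) (C : 'I_k -> cell R).
Variables (N : manifold R (k.*2).+1) (iota : N -> cell_product C) (S : acm_structure N).
Hypothesis sewN : sewed_cells hk iota S.

Let s : R := (Num.sqrt k%:R)^-1.

Let sqrtk_neq0 : Num.sqrt k%:R != 0 :> R.
Proof. by rewrite sqrtr_eq0 -ltNge ltr0n (ltnW hk). Qed.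

Section Rep.
Variables (c : chart N) (d : chart (cell_product C)).

Let L := local_rep iota c d.
Definition sewed_rep (i : 'I_k) (x : 'rV[R]_(k.*2).+1) : 'rV[R]_3 := L x *m blk i.
Definition sewed_dom := rep_dom setT iota c d.

Let smooth_iota : smooth_map setT iota.
Proof. by have [[[]]] := sewN. Qed.

Lemma sewed_dom_open : open sewed_dom.
Proof. by apply: (rep_dom_open smooth_iota); exact: openT. Qed.

Let smooth_L : smooth_on sewed_dom L.
Proof. exact: smooth_iota.2. Qed.

Lemma sewed_rep_smooth i : smooth_on sewed_dom (sewed_rep i).
Proof. by apply: smooth_mulmxr; [exact: sewed_dom_open|exact: smooth_L]. Qed.

Let jac_rep i x : sewed_dom x -> jac (sewed_rep i) x = jac L x *m blk i.
Proof. by move=> Ox; apply: jac_mulmxr; exact: smooth_diff smooth_L _ Ox. Qed.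

Let domP x : sewed_dom x ->
  exists q, [/\ chart_dom N c q, chart_dom (cell_product C) d (iota q),
    chart_map N c q = x & L x = chart_map (cell_product C) d (iota q)].
Proof.
by move=> [q [[dq _] diq] <-]; exists q; split=> //; exact: (local_rep_chart iota d dq).
Qed.

Lemma sewed_rep_img i x : sewed_dom x -> chart_img (d i) (sewed_rep i x).
Proof.
move=> /domP[q [_ diq _ Lx]]; rewrite /sewed_rep Lx prod_coordE.
by exists (iota q i) => //; exact: diq.
Qed.

Let blk_f_total i y (w : 'rV[R]_(k * 3)) : w *m f_total d y *m blk i =
  w *m blk i *m phi (cell_acm (C i)) (d i) (y *m blk i).
Proof.
rewrite /f_total mulmx_sumr.
under eq_bigr do rewrite /phi_bar !mulmxA.
by rewrite (blk_sumE (fun j => w *m blk j *m phi (cell_acm (C j)) (d j) (y *m blk j))).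
Qed.

Let blk_xi_total i y : xi_total d y *m blk i = s *: xi (cell_acm (C i)) (d i) (y *m blk i).
Proof.
rewrite /xi_total -scalemxAl.
by rewrite (blk_sumE (fun j => xi (cell_acm (C j)) (d j) (y *m blk j))).
Qed.

Let relations x : sewed_dom x ->
  [/\ forall v : 'rV[R]_(k.*2).+1,
        v *m phi S c x *m jac L x = v *m jac L x *m f_total d (L x),
      xi S c x *m jac L x = xi_total d (L x),
      forall v, ev (eta S c x) v
        = Num.sqrt k%:R * ev (eta_bar (Ordinal (ltnW hk)) d (L x)) (v *m jac L x),
      forall u v, bil (metr S c x) u v = bil (g_total d (L x)) (u *m jac L x) (v *m jac L x) &
      range (mulmxr (jac L x)) = sewing_distribution d (L x)].
Proof.
move=> /domP[q [dq diq <- ->]]; have [[[_ _ _ _ int] _] rel] := sewN.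
have [H1 H2 H3 H4] := rel c d q dq diq; have [_ H5] := int c d q dq diq.
have tE v : tangent iota c d q v = v *m jac L (chart_map N c q).
  exact: (tangent_jac smooth_iota v dq I diq).
split.
- by move=> v; rewrite -!tE.
- by rewrite -tE.
- by move=> v; rewrite -tE.
- by move=> u v; rewrite -!tE.
- by rewrite -H5; apply/seteqP; split => _ [v _ <-]; exists v => //=; rewrite tE.
Qed.

Lemma sewed_rel_phi i x : sewed_dom x -> phi S c x *m jac (sewed_rep i) x
  = jac (sewed_rep i) x *m phi (cell_acm (C i)) (d i) (sewed_rep i x).
Proof.
move=> Ox; rewrite jac_rep //; have [H _ _ _ _] := relations Ox.
apply/row_matrixP => a; rewrite !rowE; move: (delta_mx 0 a) => v.
by rewrite !mulmxA H blk_f_total.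
Qed.

Lemma sewed_rel_xi i x : sewed_dom x -> xi S c x *m jac (sewed_rep i) x
  = s *: xi (cell_acm (C i)) (d i) (sewed_rep i x).
Proof.
move=> Ox; rewrite jac_rep //; have [_ H _ _ _] := relations Ox.
by rewrite mulmxA H blk_xi_total.
Qed.

(** The structure defines eta on N through one cell only. A vector tangent to N has the form f w + a
    xi, and f w is killed by each eta_i, so every eta_i takes the same value s a on it. *)
Lemma sewed_rel_eta i x v : sewed_dom x ->
  ev (eta (cell_acm (C i)) (d i) (sewed_rep i x)) (v *m jac (sewed_rep i) x)
  = s * ev (eta S c x) v.
Proof.
move=> Ox; rewrite jac_rep //; have [_ _ He _ Hd] := relations Ox.
have [w [a vE]] : sewing_distribution d (L x) (v *m jac L x) by rewrite -Hd; exists v.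
have etaE j : ev (eta (cell_acm (C j)) (d j) (sewed_rep j x)) (v *m jac L x *m blk j) = s * a.
  rewrite vE mulmxDl -scalemxAl blk_f_total blk_xi_total evD !evZ.
  rewrite chart_eta_phi; last exact: sewed_rep_img.
  rewrite eta_xi_img; last exact: sewed_rep_img.
  by rewrite add0r mulr1 mulrC.
rewrite mulmxA etaE He; congr (_ * _).
rewrite /ev /eta_bar mulmxA -[X in _ * X]/(ev _ _) etaE.
by rewrite /s mulrA divff // mul1r.
Qed.

Lemma sewed_rel_metr x u v : sewed_dom x -> bil (metr S c x) u v =
  \sum_i bil (metr (cell_acm (C i)) (d i) (sewed_rep i x))
    (u *m jac (sewed_rep i) x) (v *m jac (sewed_rep i) x).
Proof.
move=> Ox; have [_ _ _ -> _] := relations Ox.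
rewrite /bil /g_total mulmx_sumr mulmx_suml summxE; apply: eq_bigr => i _.
by rewrite jac_rep // !trmx_mul !mulmxA.
Qed.

(** The tangent spaces of N contain Im f, and on Ker eta_i the map phi_i is onto, with inverse -
    phi_i. This explains the witness - sum_i phi_i w_i, with coefficient 0 along xi. *)
Lemma sewed_horizontal_lift x (w : 'I_k -> 'rV[R]_3) : sewed_dom x ->
  (forall i, ev (eta (cell_acm (C i)) (d i) (sewed_rep i x)) (w i) = 0) ->
  exists z : 'rV[R]_(k.*2).+1, forall i, z *m jac (sewed_rep i) x = w i.
Proof.
move=> Ox w0; have [_ _ _ _ Hd] := relations Ox.
have : sewing_distribution d (L x) (\sum_i w i *m (blk i)^T).
  exists (- \sum_i (w i *m phi (cell_acm (C i)) (d i) (sewed_rep i x)) *m (blk i)^T), 0.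
  rewrite scale0r addr0; apply: blk_inj => i; rewrite blk_sumE blk_f_total mulNmx.
  rewrite (blk_sumE (fun i => w i *m phi (cell_acm (C i)) (d i) (sewed_rep i x))).
  rewrite mulNmx phi_sqr_img; last exact: sewed_rep_img.
  by rewrite w0 scale0r addr0 opprK.
rewrite -Hd => -[z _ /= zE]; exists z => i.
by rewrite jac_rep // mulmxA zE blk_sumE.
Qed.

Lemma sewed_nullity_at x k0 mu mu' : sewed_dom x ->
  (forall i, nullity_at (cell_acm (C i)) (d i) (sewed_rep i x) k0 mu mu') ->
  nullity_at S c x (s ^+ 2 * k0) (s * mu) (s * mu').
Proof.
apply: (@nullity_at_pullback R _ _ 'I_k N (fun i => cell_man (C i)) S
   (fun i => cell_acm (C i)) c d sewed_dom sewed_rep s).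
- exact: sewed_dom_open.
- by move=> _ /domP[q [dq _ <- _]]; exists q.
- exact: sewed_rep_smooth.
- exact: sewed_rep_img.
- exact: sewed_rel_phi.
- exact: sewed_rel_xi.
- exact: sewed_rel_eta.
- exact: sewed_rel_metr.
- exact: sewed_horizontal_lift.
Qed.

Lemma sewed_htens_anticomm x : sewed_dom x ->
  phi S c x *m htens S c x + htens S c x *m phi S c x = 0.
Proof.
apply: (@htens_anticomm_pullback R _ _ 'I_k N (fun i => cell_man (C i)) S
   (fun i => cell_acm (C i)) c d sewed_dom sewed_rep s).
- exact: sewed_dom_open.
- by move=> _ /domP[q [dq _ <- _]]; exists q.
- exact: sewed_rep_smooth.
- exact: sewed_rep_img.
- exact: sewed_rel_phi.
- exact: sewed_rel_xi.
- exact: sewed_rel_metr.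
- by move=> i; exact: cell_closed.
Qed.

End Rep.
End SewedCells.

(** * Constant coefficients and the theorem *)

Lemma smooth_fun_cst (R : realType) n (M : manifold R n) (a : R) : smooth_fun (fun _ : M => a).
Proof.
move=> c t x _.
have -> : partials t ((fun _ : M => a) \o chart_inv M c : _ -> R^o)
    = cst (if t is [::] then a else 0).
  elim: t => [|i t IH] //=; rewrite IH; apply/funext => y; exact: derive_cst.
exact: differentiable_cst.
Qed.

Lemma dwedge_eq0_cst (R : realType) n (M : manifold R n) (a : R) b :
  dwedge_eq0 (fun _ : M => a) b.
Proof.
move=> c p u v dp /=.
have z w : 'd ((fun _ : M => a) \o chart_inv M c : _ -> R^o) (chart_map M c p) w = 0.
  exact: (congr1 (fun f => f w) (@diff_cst R _ R^o a (chart_map M c p))).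
by rewrite !z !mul0r subrr.
Qed.

Theorem theorem5 (R : realType) (k : nat) (hk : (1 < k)%N)
    (C : 'I_k -> cell R)
    (N : manifold R (k.*2).+1) (iota : N -> cell_product C)
    (S : acm_structure N)
    (sewN : sewed_cells hk iota S)
    (isoC : forall i j : 'I_k, i != j ->
       locally_isomorphic (cell_acm (C i)) (cell_acm (C j)))
    (kappaC muC muC' : forall i : 'I_k, C i -> R)
    (smoothC : forall i, [/\ smooth_fun (kappaC i), smooth_fun (muC i)
                           & smooth_fun (muC' i)])
    (nullC : forall i,
       nullity (cell_acm (C i)) (kappaC i) (muC i) (muC' i))
    (wedgeC : forall i,
       [/\ dwedge_eq0 (kappaC i) (eta (cell_acm (C i))),
           dwedge_eq0 (muC i) (eta (cell_acm (C i)))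
         & dwedge_eq0 (muC' i) (eta (cell_acm (C i)))]) :
  exists kappa mu mu' : N -> R,
    [/\ [/\ smooth_fun kappa, smooth_fun mu & smooth_fun mu'],
        nullity S kappa mu mu',
        [/\ dwedge_eq0 kappa (eta S), dwedge_eq0 mu (eta S)
          & dwedge_eq0 mu' (eta S)]
      & forall kappa2 mu2 mu2' : N -> R, nullity S kappa2 mu2 mu2' ->
          (forall p, kappa2 p = kappa p) /\
          (forall c p, chart_dom N c p -> htens S c (chart_map N c p) != 0 ->
             mu2 p = mu p /\ mu2' p = mu' p)].
Proof.
have [[[[q0 _] _ _ _ _] _] _] := sewN.
pose i0 := Ordinal (ltnW hk); pose i1 := Ordinal hk.
have i01 : i0 != i1 by [].
(* The constants are the values at a single point of the cell [i0]; N is nonempty, which provides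
   [q0]. *)
pose k0 := kappaC i0 (iota q0 i0).
pose m0 := muC i0 (iota q0 i0); pose m0' := muC' i0 (iota q0 i0).
have [c0 dc0] := chart_dom_cover (iota q0 i0).
have nul0 : nullity_at (cell_acm (C i0)) c0 (chart_map (C i0) c0 (iota q0 i0)) k0 m0 m0'.
  exact: (nullity_pointwise _ _ _ _).1 (nullC i0) c0 _ dc0.
have nul_other i (e : chart (C i)) p : i != i0 -> chart_dom (C i) e p ->
    nullity_at (cell_acm (C i)) e (chart_map (C i) e p) k0 m0 m0'.
  by move=> ii dp; exact: (nullity_at_iso (isoC i i0 ii) dp dc0 nul0).
have nul i (e : chart (C i)) p : chart_dom (C i) e p ->
    nullity_at (cell_acm (C i)) e (chart_map (C i) e p) k0 m0 m0'.
  have [ii|] := eqVneq i i0; last exact: nul_other.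
  subst i => dp; have [c1 dc1] := chart_dom_cover (iota q0 i1).
  (* Isomorphisms are given only between cells of distinct indices, so points of the cell [i0] are
     reached through the cell [i1], which exists since k >= 2. *)
  by apply: (nullity_at_iso (isoC i0 i1 i01) dp dc1); apply: nul_other; rewrite // eq_sym.
pose s : R := (Num.sqrt k%:R)^-1.
(* Every point of N has product coordinates around its image, so the local results on [sewed_dom]
   cover all of N. *)
have pt c p : chart_dom N c p -> exists d, sewed_dom iota c d (chart_map N c p).
  by move=> dp; have [d dd] := chart_dom_cover (iota p); exists d, p.
have nulN : nullity S (fun=> s ^+ 2 * k0) (fun=> s * m0) (fun=> s * m0').
  apply/nullity_pointwise => c p dp; have [d Ox] := pt c p dp.
  apply: (sewed_nullity_at sewN Ox) => i.
  have [r dr <-] := sewed_rep_img i Ox.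
  exact: nul.
exists (fun=> s ^+ 2 * k0), (fun=> s * m0), (fun=> s * m0'); split=> //.
- by split; exact: smooth_fun_cst.
- by split; exact: dwedge_eq0_cst.
move=> kappa2 mu2 mu2' nul2.
have uniq c p : chart_dom N c p -> kappa2 p = s ^+ 2 * k0 /\
   (htens S c (chart_map N c p) != 0 -> mu2 p = s * m0 /\ mu2' p = s * m0').
  move=> dp; have [d Ox] := pt c p dp.
  apply: (@nullity_at_unique R _ N S c (chart_map N c p)).
  - by rewrite ltnS double_gt0 (ltnW hk).
  - exact: chart_imgP.
  - exact: (sewed_htens_anticomm sewN Ox).
  - exact: (nullity_pointwise _ _ _ _).1 nulN c p dp.
  - exact: (nullity_pointwise _ _ _ _).1 nul2 c p dp.
split=> [p|c p dp]; last exact: (uniq c p dp).2.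
by have [c dp] := chart_dom_cover p; case: (uniq c p dp).
Qed.
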